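(* Let $X=\Gamma\backslash G$ be a complex parallelisable nilmanifold, let $\mathfrak g$ be the complex Lie algebra of $G$ and $\mathcal Z\mathfrak g$ its centre. For an element $\mu\in H^1(X,\Theta_X)=H^1(X,\mathcal O_X)\otimes\mathfrak g=\mathcal H^1\otimes\mathfrak g$ the following are equivalent: (1) $\mu\in H^1(X,\mathcal O_X)\otimes\mathcal Z\mathfrak g$. (2) $\mu$ defines an infinitesimally complex parallelisable deformation, i.e., regarding $\mu$ as a linear map $\bar{\mathfrak g}\to\mathfrak g$, $[Z,\mu\bar Y]=0$ for all $Z,Y\in\mathfrak g$. (3) $t\mu$ induces a 1-parameter family of complex parallelisable manifolds for $t$ small enough, i.e. provided that $(\mathrm{id}+t\mu)\bar{\mathfrak g}\oplus\overline{(\mathrm{id}+t\mu)\bar{\mathfrak g}}=\mathfrak g_{\mathbb C}$: for all such $t$ one has $\mathrm{obs}(t\mu)=0$ and $(\mathrm{id}+\Phi(t\mu))\bar{\mathfrak g}$ is the space of $(0,1)$-vectors of a left-invariant complex structure which is complex parallelisable. Hence the Kuranishi family is (locally) a cylinder over an analytic subset of $H^1(X,\mathcal O_X)\otimes(\mathfrak g/\mathcal Z\mathfrak g)$; that is, near $0$ the space $\mathrm{Kur}(X)$ is the preimage of an analytic subset under the projection $H^1(X,\mathcal O_X)\otimes\mathfrak g\to H^1(X,\mathcal O_X)\otimes(\mathfrak g/\mathcal Z\mathfrak g)$.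
   Context: Setting: $G$ is a simply connected complex nilpotent Lie group with Lie algebra $\mathfrak g$, $\Gamma\subset G$ a lattice (discrete cocompact subgroup), and $X=\Gamma\backslash G$ the resulting compact complex manifold, called a complex parallelisable nilmanifold. Write $\mathfrak h$ for the real Lie algebra underlying $\mathfrak g$ and $M$ for the underlying real nilmanifold. The complexification of $\mathfrak h$ is $\mathfrak g_{\mathbb C}=\mathfrak h\otimes_{\mathbb R}\mathbb C=\mathfrak g\oplus\bar{\mathfrak g}$ with $[\bar x,\bar y]=\overline{[x,y]}$ and $[\mathfrak g,\bar{\mathfrak g}]=0$; here $\mathfrak g$ is the space of left-invariant $(1,0)$-vectors and $\bar{\mathfrak g}$ that of $(0,1)$-vectors. A left-invariant almost complex structure $J'$ on $M$ corresponds to a decomposition $\mathfrak g_{\mathbb C}=W\oplus\overline W$, $\overline W$ being the space of $(0,1)$-vectors; it is integrable iff $[W,W]\subset W$. It is complex parallelisable if $(\mathfrak h,J')$ is a complex Lie algebra (the bracket is $J'$-bilinear), equivalently $J'$ is integrable and $[W,\overline W]=0$. A linear map $\Psi:\bar{\mathfrak g}\to\mathfrak g$, i.e. $\Psi\in\bar{\mathfrak g}^*\otimes\mathfrak g$, encodes the space of $(0,1)$-vectors $(\mathrm{id}+\Psi)\bar{\mathfrak g}$. Let $\bar\partial:\bar{\mathfrak g}^*\to\Lambda^2\bar{\mathfrak g}^*$ be $(\bar\partial\bar\alpha)(\bar x,\bar y)=-\bar\alpha([\bar x,\bar y])$, extended as a derivation to $\Lambda^*\bar{\mathfrak g}^*$,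 and extended to $\Lambda^*\bar{\mathfrak g}^*\otimes\mathfrak g$ by $\bar\partial(\bar\alpha\otimes X)=(\bar\partial\bar\alpha)\otimes X$. The Schouten bracket on $\bar{\mathfrak g}^*\otimes\mathfrak g$ with values in $\Lambda^2\bar{\mathfrak g}^*\otimes\mathfrak g$ is in this setting bilinear with $[\bar\alpha\otimes X,\bar\beta\otimes Y]=\bar\alpha\wedge\bar\beta\otimes[X,Y]$. Fix a hermitian inner product on $\mathfrak g$, with induced inner products on $\Lambda^k\bar{\mathfrak g}^*$; let $\bar\partial^*$ be the adjoint of $\bar\partial$, $\Delta=\bar\partial\bar\partial^*+\bar\partial^*\bar\partial$, $\mathcal H^k=\ker(\Delta|_{\Lambda^k\bar{\mathfrak g}^*})$, $B^k=\bar\partial(\Lambda^{k-1}\bar{\mathfrak g}^* )$, $V^k=\bar\partial^*(\Lambda^{k+1}\bar{\mathfrak g}^* )$, so that $\Lambda^k\bar{\mathfrak g}^*=B^k\oplus\mathcal H^k\oplus V^k$ orthogonally. One has $B^1=0$, $H^1(X,\mathcal O_X)\cong\mathcal H^1=\ker(\bar\partial|_{\bar{\mathfrak g}^*})=\overline{\mathrm{Ann}([\mathfrak g,\mathfrak g])}$, and $H^1(X,\Theta_X)\cong\mathcal H^1\otimes\mathfrak g$, where $\Theta_X$ is the holomorphic tangent sheaf. Let $P$ and $H$ be the orthogonal projections of $\Lambda^2\bar{\mathfrak g}^*\otimes\mathfrak g$ onto $B^2\otimes\mathfrak g$ and $\mathcal H^2\otimes\mathfrak g$, and let $\delta:B^2\otimes\mathfrak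 g\to V^1\otimes\mathfrak g$ be the inverse of the isomorphism $\bar\partial:V^1\otimes\mathfrak g\to B^2\otimes\mathfrak g$. For $\mu\in\mathcal H^1\otimes\mathfrak g$ set $\Phi_1=\mu$, $\Phi_k=-\delta P\sum_{1\le i<k}[\Phi_i,\Phi_{k-i}]$ for $k\ge2$, and $\Phi(\mu)=\sum_{k\ge1}\Phi_k$. The obstruction map is $\mathrm{obs}(\mu)=H[\Phi(\mu),\Phi(\mu)]\in\mathcal H^2\otimes\mathfrak g$. The Kuranishi space is the complex analytic space $\mathrm{Kur}(X)=\{\mu\in\mathcal H^1\otimes\mathfrak g: \|\mu\|<\epsilon,\ \mathrm{obs}(\mu)=0\}$ for small $\epsilon>0$; the deformation attached to $\mu\in\mathrm{Kur}(X)$ is the left-invariant complex structure on $M$ with $(0,1)$-vectors $(\mathrm{id}+\Phi(\mu))\bar{\mathfrak g}$. *)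

(* Defs.v *)
From HB Require Import structures.
From mathcomp Require Import all_boot all_order all_algebra.
From mathcomp Require Import complex.
From mathcomp Require Import boolp classical_sets reals topology normedtype.
From mathcomp Require Import sequences derive.

Set Implicit Arguments.
Unset Strict Implicit.
Unset Printing Implicit Defensive.

Import Order.TTheory GRing.Theory Num.Theory.
Import numFieldNormedType.Exports.

Local Open Scope classical_set_scope.
Local Open Scope ring_scope.

(* The complex numbers, packed so that rows and matrices over them receive
   the normed topology that MathComp-Analysis gives to any numFieldType. *)
Definition Cplx (R : realType) : numClosedFieldType := R[i].

Section LinearAlgebra.
Variable R : realType.
Local Notation C := (Cplx R).

Definition span_set (V : lmodType C) (S : set V) : set V :=
  [set v | exists (k : nat) (a : 'I_k -> C) (u : 'I_k -> V),
     (forall i, S (u i)) /\ v = \sum_i a i *: u i].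

(* The tensor product of the space of column vectors of height p with that of
   row vectors of width q is 'M_(p, q), with a (x) b = a *m b; [tens A B] is
   the subspace of it that is the tensor product of the subspaces A and B. *)
Definition tens (p q : nat) (A : set 'cV[C]_p) (B : set 'rV[C]_q) :
    set 'M[C]_(p, q) :=
  span_set [set z | exists2 a, A a & exists2 b, B b & z = a *m b].

(* The orthogonal projection of v onto the subspace U (v - p orthogonal
   to U). *)
Definition orth_proj (V : lmodType C) (dot : V -> V -> C) (U : set V)
    (v : V) : V :=
  xget 0 [set p | U p /\ forall u, U u -> dot (v - p) u = 0].

Definition adjoint (V : lmodType C) (dot : V -> V -> C) (f : V -> V)
    (v : V) : V :=
  xget 0 [set w | forall u, dot (f u) v = dot u w].

Definition direct_decomposition (V : lmodType C) (U W : set V) :=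
  (forall v, exists u w, [/\ U u, W w & v = u + w]) /\
  (forall v, U v -> W v -> v = 0).

End LinearAlgebra.

Section LieAlgebra.
Variables (R : realType) (n : nat).
Local Notation C := (Cplx R).
Local Notation g := 'rV[C]_n.
Variable br : g -> g -> g.

(* For a bilinear br. *)
Definition lie_bracket :=
  (forall x, br x x = 0) /\
  (forall x y z, br x (br y z) + br y (br z x) + br z (br x y) = 0).

Fixpoint lower_central (k : nat) : set g :=
  if k is k'.+1 then
    span_set [set z | exists x, exists2 y, lower_central k' y & z = br x y]
  else setT.

Definition nilpotent_lie := exists k, lower_central k `<=` [set 0].

Definition lie_centre : set g := [set z | forall x, br x z = 0].

Fixpoint nested_bracket (s : seq g) : g :=
  if s is x :: s' then
    if s' is [::] then x else br x (nested_bracket s')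
  else 0.

(* The simply connected nilpotent Lie group G with Lie algebra g is g itself,
   via exp, with the Baker-Campbell-Hausdorff product.  This is Dynkin's
   formula
     sum_k (-1)^(k-1)/k sum_(r_i + s_i > 0)
        [x^(r_1) y^(s_1) ... x^(r_k) y^(s_k)]
          / ((sum_i (r_i + s_i)) prod_i r_i! s_i!)
   with right-nested brackets; k, r_i and s_i may be bounded by n = dim g
   since iterated brackets of more than n elements of a nilpotent Lie algebra
   of dimension n vanish.  The unit is 0 and the inverse of x is - x. *)
Definition bch (x y : g) : g :=
  \sum_(1 <= k < n.+1) ((-1) ^+ k.-1 / k%:R) *:
    \sum_(w : {ffun 'I_k -> 'I_n.+1 * 'I_n.+1} |
            [forall i, (0 < (w i).1 + (w i).2)%N])
      ((\sum_i ((w i).1 + (w i).2))%N%:R *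
       (\prod_i ((w i).1`! * (w i).2`!))%N%:R)^-1 *:
      nested_bracket
        (flatten [seq nseq (w i).1 x ++ nseq (w i).2 y | i <- enum 'I_k]).

(* A discrete subgroup Gam of G such that G = Gam K for some compact K. *)
Definition lie_lattice (Gam : set g) :=
  [/\ Gam 0,
      (forall x y, Gam x -> Gam y -> Gam (bch x y)),
      (forall x, Gam x -> Gam (- x)),
      (forall x, Gam x -> \forall y \near x, Gam y -> y = x) &
      exists2 K : set g, compact K &
        forall x, exists a k, [/\ Gam a, K k & x = bch a k]].

(* The conjugate space of g is again 'rV_n: the row a stands for the vector
   with coordinates a in the conjugates of the standard basis of g, so that
   x |-> conjv x is the conjugation from g to its conjugate, and back. *)
Definition conjv (x : g) : g := map_mx Num.conj x.

Definition conj_br (a b : g) : g := conjv (br (conjv a) (conjv b)).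

(* The complexification of the real Lie algebra h underlying g, as the sum of
   g and its conjugate: first component (1,0), second component (0,1). *)
Definition gC := (g * g)%type.

Definition brC (u v : gC) : gC := (br u.1 v.1, conj_br u.2 v.2).

Definition conj_gC (u : gC) : gC := (conjv u.2, conjv u.1).

(* The inclusion of h in its complexification; h has the same elements
   as g. *)
Definition real_vector (x : g) : gC := (x, conjv x).

(* J is an R-linear endomorphism of h. *)
Definition almost_complex (J : g -> g) :=
  [/\ (forall x y, J (x + y) = J x + J y),
      (forall (a : C) x, a \is Num.real -> J (a *: x) = a *: J x) &
      (forall x, J (J x) = - x)].

(* The eigenspace for - 'i of the C-linear extension of J. *)
Definition vectors01 (J : g -> g) : set gC :=
  [set real_vector x + 'i *: real_vector (J x) | x in setT].

Definition integrable (J : g -> g) :=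
  forall u v, (conj_gC @` vectors01 J) u -> (conj_gC @` vectors01 J) v ->
    (conj_gC @` vectors01 J) (brC u v).

Definition complex_parallelisable (J : g -> g) :=
  forall x y, br (J x) y = J (br x y) /\ br x (J y) = J (br x y).

End LieAlgebra.

Section Forms.
Variables (R : realType) (n : nat).
Local Notation C := (Cplx R).
Local Notation g := 'rV[C]_n.

(* The exterior algebra of the dual of the conjugate of g has as basis the
   monomials E_S = E_(i_1) /\ ... /\ E_(i_k), for S = {i_1 < ... < i_k}, where
   E_i is the basis dual to the conjugates of the standard basis of g. *)
Definition ext_dim := #|{: {set 'I_n}}|.
Local Notation N := ext_dim.

Definition mono (S : {set 'I_n}) : 'cV[C]_N := delta_mx (enum_rank S) 0.

(* 'M_(N, p) is the tensor product of the exterior algebra with C^p: forms are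
   the case p = 1 and g-valued forms the case p = n.  T is the sum over S of
   E_S (x) coef T S. *)
Definition coef (p : nat) (T : 'M[C]_(N, p)) (S : {set 'I_n}) : 'rV[C]_p :=
  row (enum_rank S) T.

Definition Lam (k : nat) : set 'cV[C]_N :=
  [set w | forall S : {set 'I_n}, #|S| != k -> coef w S = 0].

Definition mono_wedge (S T : {set 'I_n}) : 'cV[C]_N :=
  if [disjoint S & T] then
    (-1) ^+ #|[set ij : 'I_n * 'I_n |
                 [&& ij.1 \in S, ij.2 \in T & (ij.2 < ij.1)%N]]|
      *: mono (S :|: T)
  else 0.

Definition wedge (u v : 'cV[C]_N) : 'cV[C]_N :=
  \sum_(S : {set 'I_n}) \sum_(T : {set 'I_n})
    (coef u S 0 0 * coef v T 0 0) *: mono_wedge S T.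

(* A g-valued 1-form as a linear map from the conjugate of g to g. *)
Definition eval1 (T : 'M[C]_(N, n)) (a : g) : g :=
  \sum_(i < n) a 0 i *: coef T [set i].

(* (id + Psi) applied to the conjugate of g, inside the complexification. *)
Definition graph01 (Psi : 'M[C]_(N, n)) : set (gC R n) :=
  [set (eval1 Psi a, a) | a in setT].

Section Bracket.
Variable br : g -> g -> g.

Local Notation e_ i := (delta_mx 0 i : g).

(* Value on the j-th and k-th basis vectors of the conjugate of g:
   - E_i([.,.]). *)
Definition dbar_gen (i : 'I_n) : 'cV[C]_N :=
  \sum_(j < n) \sum_(k < n | (j < k)%N)
    - (conj_br br (e_ j) (e_ k) 0 i) *: mono [set j; k].

(* Graded Leibniz rule: writing E_S = (-1)^m E_i /\ E_(S - i), where m is the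
   number of j < i in S, the term of dbar E_S in which E_i is differentiated
   is (-1)^m (dbar E_i) /\ E_(S - i). *)
Definition dbar_mono (S : {set 'I_n}) : 'cV[C]_N :=
  \sum_(i in S)
    (-1) ^+ #|[set j in S | (j < i)%N]| *: wedge (dbar_gen i) (mono (S :\ i)).

Definition dbar (p : nat) (T : 'M[C]_(N, p)) : 'M[C]_(N, p) :=
  \sum_(S : {set 'I_n}) dbar_mono S *m coef T S.

(* Only meant for 1-forms with values in g. *)
Definition schouten (T U : 'M[C]_(N, n)) : 'M[C]_(N, n) :=
  \sum_(i < n) \sum_(j < n)
    wedge (mono [set i]) (mono [set j]) *m br (coef T [set i]) (coef U [set j]).

Variable dotg : g -> g -> C.

(* Gram matrix of the E_i.  If M is the Gram matrix of the standard basis of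
   g, the conjugate basis has Gram matrix M^T, and the dual of the latter has
   Gram matrix M^-1. *)
Definition gram1 : 'M[C]_n := invmx (\matrix_(i, j) dotg (e_ i) (e_ j)).

(* <a_1 /\ .. /\ a_k, b_1 /\ .. /\ b_k> = det (<a_i, b_j>). *)
Definition gram (S T : {set 'I_n}) : C :=
  match #|S| =P #|T| with
  | ReflectT eq_ST =>
      \det (\matrix_(i < #|S|, j < #|S|)
              gram1 (enum_val i) (enum_val (cast_ord eq_ST j)))
  | ReflectF _ => 0
  end.

Definition dot_form (u v : 'cV[C]_N) : C :=
  \sum_(S : {set 'I_n}) \sum_(T : {set 'I_n})
    gram S T * (coef u S 0 0 * (coef v T 0 0)^*).

Definition dot_gform (T U : 'M[C]_(N, n)) : C :=
  \sum_(S : {set 'I_n}) \sum_(S' : {set 'I_n})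
    gram S S' * dotg (coef T S) (coef U S').

Definition dbar_star : 'cV[C]_N -> 'cV[C]_N := adjoint dot_form (@dbar 1).

Definition laplacian (u : 'cV[C]_N) : 'cV[C]_N :=
  dbar (dbar_star u) + dbar_star (dbar u).

Definition harmonic_forms (k : nat) : set 'cV[C]_N :=
  Lam k `&` [set u | laplacian u = 0].

(* For k = 0 this is the zero space, as dbar vanishes on constants. *)
Definition exact_forms (k : nat) : set 'cV[C]_N := @dbar 1 @` Lam k.-1.

Definition coexact_forms (k : nat) : set 'cV[C]_N := dbar_star @` Lam k.+1.

Definition projB : 'M[C]_(N, n) -> 'M[C]_(N, n) :=
  orth_proj dot_gform (tens (exact_forms 2) setT).

Definition projH : 'M[C]_(N, n) -> 'M[C]_(N, n) :=
  orth_proj dot_gform (tens (harmonic_forms 2) setT).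

(* Inverse of dbar : V^1 (x) g -> B^2 (x) g. *)
Definition delta (w : 'M[C]_(N, n)) : 'M[C]_(N, n) :=
  xget 0 [set v | tens (coexact_forms 1) setT v /\ dbar v = w].

(* [:: 0; Phi_1; ...; Phi_k]. *)
Fixpoint Phi_seq (mu : 'M[C]_(N, n)) (k : nat) : seq 'M[C]_(N, n) :=
  match k with
  | 0 => [:: 0]
  | 1 => [:: 0; mu]
  | k'.+1 => let s := Phi_seq mu k' in
      rcons s (- delta (projB (\sum_(1 <= i < k) schouten s`_i s`_(k - i))))
  end.

Definition Phi_ (mu : 'M[C]_(N, n)) (k : nat) : 'M[C]_(N, n) :=
  (Phi_seq mu k)`_k.

Definition Phi (mu : 'M[C]_(N, n)) : 'M[C]_(N, n) :=
  limn (series (Phi_ mu)).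

Definition obs (mu : 'M[C]_(N, n)) : 'M[C]_(N, n) :=
  projH (schouten (Phi mu) (Phi mu)).

Definition Kur (eps : C) : set 'M[C]_(N, n) :=
  [set mu | [/\ tens (harmonic_forms 1) setT mu, sqrtC (dot_gform mu mu) < eps &
                obs mu = 0]].

Lemma size_Phi_seq mu k : size (Phi_seq mu k) = k.+1.
Proof.
elim: k => [//|k IHk]; case: k IHk => [//|k IHk].
by rewrite -[Phi_seq mu k.+2]/(rcons (Phi_seq mu k.+1) _) size_rcons IHk.
Qed.

Lemma nth_Phi_seq mu k i : (i <= k)%N -> (Phi_seq mu k)`_i = Phi_ mu i.
Proof.
elim: k => [|k IHk]; first by rewrite leqn0 => /eqP->.
rewrite leq_eqVlt => /predU1P[-> //|]; rewrite ltnS => ik.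
case: k IHk ik => [|k] IHk ik; first by move: ik; rewrite leqn0 => /eqP->.
rewrite -[Phi_seq mu k.+2]/(rcons (Phi_seq mu k.+1) _) nth_rcons.
by rewrite size_Phi_seq ltnS ik IHk.
Qed.

Lemma Phi_1 mu : Phi_ mu 1 = mu.
Proof. by []. Qed.

Lemma Phi_rec mu k : (2 <= k)%N ->
  Phi_ mu k =
    - delta (projB (\sum_(1 <= i < k) schouten (Phi_ mu i) (Phi_ mu (k - i)))).
Proof.
case: k => [//|[//|k]] _; rewrite {1}/Phi_.
rewrite -[Phi_seq mu k.+2]/(rcons (Phi_seq mu k.+1) (- delta (projB
  (\sum_(1 <= i < k.+2) schouten (Phi_seq mu k.+1)`_i
                                 (Phi_seq mu k.+1)`_(k.+2 - i))))).
rewrite nth_rcons size_Phi_seq ltnn eqxx; congr (- delta (projB _)).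
apply: eq_big_nat => i /andP[i1 ik].
by rewrite !nth_Phi_seq // leq_subLR addnC -addn1 leq_add2l.
Qed.

End Bracket.
End Forms.

Section Analytic.
Variables (R : realType) (p q : nat).
Local Notation C := (Cplx R).
Local Notation E := 'M[C]_(p, q).

(* Complex differentiable at each point of U, which is meant to be open. *)
Definition holomorphic_on (U : set E) (f : E -> C) :=
  forall x, U x -> differentiable f x.

(* A is an analytic subset of the open subset V `&` D of the linear subspace
   D, cut out by the finitely many equations f.  Holomorphic functions on an
   open subset of D are locally restrictions of holomorphic functions on open
   subsets of the ambient space. *)
Definition analytic_subset (D V : set E) (r : nat) (f : 'I_r -> E -> C)
    (A : set E) :=
  [/\ open V, (forall i, holomorphic_on V (f i)) &
      A = [set x | [/\ D x, V x & forall i, f i x = 0]]].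

(* The functions f_i and h_j, restricted to U `&` D, generate the same ideal
   of holomorphic functions. *)
Definition same_ideal (D U : set E) (I J : finType)
    (f : I -> E -> C) (h : J -> E -> C) :=
  exists (a : I -> J -> E -> C) (b : J -> I -> E -> C),
    [/\ (forall i j, holomorphic_on U (a i j)),
        (forall j i, holomorphic_on U (b j i)),
        (forall x, D x -> U x -> forall i, f i x = \sum_j a i j x * h j x) &
        (forall x, D x -> U x -> forall j, h j x = \sum_i b j i x * f i x)].

End Analytic.

(* Main.v *)
(* As [delta], P and H act on forms only, [Phi_k(mu)] has its coefficients ever
   deeper in the lower central series of g; by nilpotency [Phi] is a polynomial
   map, and since brackets ignore central summands, [obs] factors through the
   quotient by the centre: this is the cylinder.  If mu is central all brackets
   vanish, so [Phi(t mu) = t mu] and [obs(t mu) = 0], and the complex structure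
   is parallelisable because mu, being closed, kills commutators.  Conversely,
   parallelisability forces [Phi(t mu)] to have central values for one small
   t <> 0; as [Phi(t mu) - t mu] lies in [V^1 (x) g], which meets
   [H^1 (x) g] trivially, mu itself is central.  The orthogonal projections
   and adjoints exist because the Gram matrix of the exterior algebra is the
   compound of a positive definite matrix, hence of the form D D^* with D
   invertible by the Cauchy-Binet formula. *)
Require Import Defs.
From HB Require Import structures.
From mathcomp Require Import all_boot all_order all_algebra.
From mathcomp Require Import fingroup perm complex.
From mathcomp Require Import boolp classical_sets reals topology normedtype.
From mathcomp Require Import sequences derive ring.

Set Implicit Arguments.
Unset Strict Implicit.
Unset Printing Implicit Defensive.

Import Order.TTheory GRing.Theory Num.Theory.
Import numFieldNormedType.Exports.

Local Open Scope classical_set_scope.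
Local Open Scope ring_scope.

(** * Cauchy-Binet and compound matrices *)

(** [orth_proj], [adjoint] and [delta] are choices made by [xget] and carry no linearity of their
    own. Each one that is needed ([delta] together with [projB]) is therefore identified once, by
    existence and uniqueness, with left multiplication by a matrix, whereas a subspace of g enters
    through a projector multiplied on the right. The two actions commute. This is why depth in the
    lower central series survives [delta] and P, and why membership in V^1 (x) g survives killing
    the centre. Condition (3) assumes that the decomposition is direct for the given [t], and at
    [t = 0] it says nothing about [mu]. A usable nonzero [t] is found among the numbers 1/(k+1) by
    counting eigenvalues, without estimates. The remaining obstacle is that (3) makes Phi(t mu)
    central and not t mu itself; the two are compared after multiplying on the right by [1%:M - Q],
    with [Q] a projector onto the centre. *)

Section CauchyBinet.
Variable K : comPzRingType.

(** Each row of [A *m B] is a combination of the rows of [B], so multilinearity gives a sum over all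
    choices [f] of rows. A choice that takes a row twice contributes a determinant with two equal
    rows. *)
Lemma det_mulmx_ffun k n (A : 'M[K]_(k, n)) (B : 'M[K]_(n, k)) :
  \det (A *m B) = \sum_(f : {ffun 'I_k -> 'I_n} | injectiveb f)
     (\prod_i A i (f i)) * \det (\matrix_(i, j) B (f i) j).
Proof.
transitivity (\sum_(f : {ffun 'I_k -> 'I_n})
     (\prod_i A i (f i)) * \det (\matrix_(i, j) B (f i) j)).
  pose AB (s : 'S_k) i j := A i j * B j (s i).
  transitivity (\sum_(f : {ffun 'I_k -> 'I_n}) \sum_(s : 'S_k)
     (-1) ^+ s * \prod_i AB s i (f i)).
    rewrite exchange_big; apply: eq_bigr => /= s _; rewrite -big_distrr /=.
    congr (_ * _); rewrite -(bigA_distr_bigA (AB s)) /=.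
    by apply: eq_bigr => x _; rewrite mxE.
  apply: eq_bigr => f _; rewrite big_distrr /=; apply: eq_bigr => s _.
  rewrite mulrCA big_split //=; congr (_ * (_ * _)).
  by apply: eq_bigr => x _; rewrite mxE.
rewrite (bigID (fun f : {ffun 'I_k -> 'I_n} => injectiveb f)) /= [X in _ + X]big1.
  by rewrite addr0.
move=> f /injectivePn[i1 [i2 Di12 Ef12]].
by rewrite (determinant_alternate Di12) ?mulr0 //= => j; rewrite !mxE Ef12.
Qed.

(** The injective maps with image [L] are the composites of [e] with a permutation. Each permutation
    pulls its sign out of the minor of [B], and the signed products of entries of [A] add up to the
    other determinant. *)
Lemma det_mulmx_image k n (A : 'M[K]_(k, n)) (B : 'M[K]_(n, k))
    (e : 'I_k -> 'I_n) (L : {set 'I_n}) :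
  injective e -> e @: 'I_k = L ->
  \sum_(f : {ffun 'I_k -> 'I_n} | injectiveb f && (f @: 'I_k == L))
     (\prod_i A i (f i)) * \det (\matrix_(i, j) B (f i) j) =
  \det (\matrix_(i, j) A i (e j)) * \det (\matrix_(i, j) B (e i) j).
Proof.
move=> e_inj eL.
pose h (s : 'S_k) := [ffun i => e (s i)].
have h_inj : injective h.
  by move=> s t /ffunP st; apply/permP => i; apply: e_inj; have := st i; rewrite !ffunE.
have imh f : (f \in h @: 'S_k) = injectiveb f && (f @: 'I_k == L).
  apply/imsetP/andP => [[s _ ->]|[/injectiveP f_inj /eqP fL]].
    split; first by apply/injectiveP => i j; rewrite !ffunE => /e_inj/perm_inj.
    rewrite -eL; apply/eqP/setP => x; apply/imsetP/imsetP => -[i _ ->].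
      by exists (s i); rewrite ?ffunE.
    by exists (s^-1%g i); rewrite ?ffunE ?permKV.
  have f_e i : exists j, e j == f i.
    have : f i \in e @: 'I_k by rewrite eL -fL imset_f.
    by case/imsetP => j _ ->; exists j.
  pose s i := xchoose (f_e i).
  have sE i : e (s i) = f i by apply/eqP; exact: (xchooseP (f_e i)).
  have s_inj : injective s by move=> i j sij; apply: f_inj; rewrite -!sE sij.
  by exists (perm s_inj) => //; apply/ffunP => i; rewrite ffunE permE sE.
rewrite -(eq_bigl _ _ imh) big_imset /=; last by move=> s t _ _ /h_inj.
rewrite [X in _ = X * _]/determinant big_distrl /=; apply: eq_big => //= s _.
have -> : \matrix_(i, j) B (h s i) j = row_perm s (\matrix_(i, j) B (e i) j).
  by apply/matrixP => i j; rewrite !mxE ffunE.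
rewrite row_permE det_mulmx det_perm mulrCA mulrA; congr (_ * _ * _).
by apply: eq_bigr => i _; rewrite !mxE ffunE.
Qed.

Section Compound.
Variable n : nat.
Implicit Types (A B : 'M[K]_n) (S T L : {set 'I_n}).

(** The body repeats that of [gram], so that [gram] is by conversion a minor of [gram1]. *)
Definition minor A S T : K :=
  match #|S| =P #|T| with
  | ReflectT eq_ST =>
      \det (\matrix_(i < #|S|, j < #|S|)
              A (enum_val i) (enum_val (cast_ord eq_ST j)))
  | ReflectF _ => 0
  end.

(** With a free size [k] both index sets are cast to one type, so three sets of equal cardinality
    can be handled together. *)
Lemma minorE A S T k (eS : k = #|S|) (eT : k = #|T|) :
  minor A S T = \det (\matrix_(i < k, j < k)
     A (enum_val (cast_ord eS i)) (enum_val (cast_ord eT j))).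
Proof.
rewrite /minor; case: eqP => [e|]; last by case; rewrite -eS.
subst k.
congr (\det _); apply/matrixP => i j; rewrite !mxE.
by rewrite cast_ord_id (eq_irrelevance e eT).
Qed.

Lemma minor_card A S T : #|S| <> #|T| -> minor A S T = 0.
Proof. by rewrite /minor; case: eqP. Qed.

(** The Cauchy-Binet formula: the injective maps of [det_mulmx_ffun] are grouped by their image
    [L]. *)
Lemma minor_mul A B S T :
  minor (A *m B) S T = \sum_(L : {set 'I_n}) minor A S L * minor B L T.
Proof.
case: (eqVneq #|S| #|T|) => [eST|/eqP nST]; last first.
  rewrite minor_card // big1 // => L _.
  case: (eqVneq #|S| #|L|) => [eSL|/eqP nSL]; last by rewrite minor_card ?mul0r.
  by rewrite [X in _ * X]minor_card ?mulr0 // -eSL.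
pose eS := erefl #|S|; rewrite (minorE _ eS eST).
set As := \matrix_(i < #|S|, j < n) A (enum_val (cast_ord eS i)) j.
set Bt := \matrix_(i < n, j < #|S|) B i (enum_val (cast_ord eST j)).
transitivity (\det (As *m Bt)).
  congr (\det _); apply/matrixP => i j; rewrite !mxE.
  by apply: eq_bigr => l _; rewrite !mxE.
rewrite det_mulmx_ffun.
rewrite (partition_big (fun f : {ffun _ -> _} => f @: 'I_#|S|) predT) //=.
apply: eq_bigr => L _; case: (eqVneq #|S| #|L|) => [eSL|nSL]; last first.
  rewrite minor_card; last exact/eqP; rewrite mul0r big1 // => f /andP[/injectiveP fi /eqP fL].
  by case/eqP: nSL; rewrite -fL card_imset // card_ord.
rewrite (@det_mulmx_image _ _ _ _ (fun i => enum_val (cast_ord eSL i))).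
- rewrite (minorE _ eS eSL) (minorE _ eSL eST).
  by congr (_ * _); congr (\det _); apply/matrixP => i j; rewrite !mxE.
- by move=> i j /enum_val_inj/cast_ord_inj.
- apply/setP => x; apply/imsetP/idP => [[i _ ->]|Lx]; first exact: enum_valP.
  exists (cast_ord (esym eSL) (enum_rank_in Lx x)) => //.
  by rewrite cast_ordKV enum_rankK_in.
Qed.

Lemma minor1 S T : minor 1%:M S T = (S == T)%:R.
Proof.
case: (eqVneq S T) => [<-|nST].
  rewrite (minorE _ (erefl _) (erefl _)) -[RHS](det1 K #|S|); congr (\det _).
  by apply/matrixP => i j; rewrite !mxE (inj_eq enum_val_inj) !cast_ord_id.
case: (eqVneq #|S| #|T|) => [eST|/eqP nc]; last by rewrite minor_card.
have /subsetPn[x Sx nTx] : ~~ (S \subset T).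
  by apply: contra nST => sST; rewrite eqEcard sST eST leqnn.
(* The row of an element of [S] outside [T] is zero. *)
rewrite (minorE _ (erefl _) eST) (expand_det_row _ (enum_rank_in Sx x)) big1 // => j _.
rewrite mxE cast_ord_id enum_rankK_in // mxE; case: eqP => [xE|]; rewrite ?mul0r //.
by case/negP: nTx; rewrite xE enum_valP.
Qed.

Lemma minor_tr A S T : minor A^T S T = minor A T S.
Proof.
case: (eqVneq #|S| #|T|) => [eST|/eqP nc]; last by rewrite !minor_card //; apply/nesym.
rewrite (minorE _ (erefl _) eST) (minorE _ eST (erefl _)) -det_tr.
by congr (\det _); apply/matrixP => i j; rewrite !mxE.
Qed.

Lemma minor_map (phi : {rmorphism K -> K}) A S T :
  minor (map_mx phi A) S T = phi (minor A S T).
Proof.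
case: (eqVneq #|S| #|T|) => [eST|/eqP nc]; last by rewrite !minor_card ?rmorph0.
rewrite !(minorE _ (erefl _) eST) -det_map_mx.
by congr (\det _); apply/matrixP => i j; rewrite !mxE.
Qed.

(** The compounds of all orders in one matrix, with a diagonal block for each cardinality; it is
    indexed like the basis [mono]. *)
Definition compound_mx A : 'M[K]_(ext_dim n) :=
  \matrix_(i, j) minor A (enum_val i) (enum_val j).

Lemma compound_mxM A B : compound_mx (A *m B) = compound_mx A *m compound_mx B.
Proof.
apply/matrixP => i j; rewrite !mxE minor_mul.
rewrite (reindex (enum_val (A := {: {set 'I_n}}))) /=; last exact/onW_bij/enum_val_bij.
by apply: eq_bigr => l _; rewrite !mxE.
Qed.

Lemma compound_mx1 : compound_mx 1%:M = 1%:M.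
Proof. by apply/matrixP => i j; rewrite !mxE minor1 (inj_eq enum_val_inj). Qed.

Lemma compound_mx_tr A : compound_mx A^T = (compound_mx A)^T.
Proof. by apply/matrixP => i j; rewrite !mxE minor_tr. Qed.

Lemma compound_mx_map (phi : {rmorphism K -> K}) A :
  compound_mx (map_mx phi A) = map_mx phi (compound_mx A).
Proof. by apply/matrixP => i j; rewrite !mxE minor_map. Qed.

End Compound.
End CauchyBinet.

Lemma compound_mx_unit (K : comUnitRingType) n (A : 'M[K]_n) :
  A \in unitmx -> compound_mx A \in unitmx.
Proof.
move=> uA; have: compound_mx A *m compound_mx (invmx A) = 1%:M.
  by rewrite -compound_mxM mulmxV // compound_mx1.
by case/mulmx1_unit.
Qed.

Lemma eq_cols (T : Type) p q (A B : 'M[T]_(p, q)) :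
  (forall j, col j A = col j B) -> A = B.
Proof. by move=> AB; apply/matrixP => i j; have /colP/(_ i) := AB j; rewrite !mxE. Qed.

(** * Subspaces and positive definite forms *)

Section Subspace.
Variable C : numClosedFieldType.

Definition subspace (V : lmodType C) (U : set V) :=
  U 0 /\ forall a u v, U u -> U v -> U (a *: u + v).

Lemma subspaceZ (V : lmodType C) (U : set V) a u : subspace U -> U u -> U (a *: u).
Proof. by move=> [U0 UD] Uu; rewrite -[_ *: _]addr0; apply: UD. Qed.

Lemma subspaceD (V : lmodType C) (U : set V) u v :
  subspace U -> U u -> U v -> U (u + v).
Proof. by move=> [U0 UD] Uu Uv; rewrite -[u]scale1r; apply: UD. Qed.

Lemma subspaceB (V : lmodType C) (U : set V) u v :
  subspace U -> U u -> U v -> U (u - v).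
Proof. by move=> [U0 UD] Uu Uv; rewrite addrC -scaleN1r; apply: UD. Qed.

Lemma subspace_sum (V : lmodType C) (U : set V) (I : Type) (r : seq I)
    (P : pred I) (F : I -> V) :
  subspace U -> (forall i, P i -> U (F i)) -> U (\sum_(i <- r | P i) F i).
Proof.
move=> sU UF; apply: (big_ind U) => //; first by case: sU.
by move=> u v; apply: subspaceD.
Qed.

Lemma subspaceT (V : lmodType C) : subspace [set: V].
Proof. by []. Qed.

Lemma subspace_image_mulmx n p (A : 'M[C]_(n, p)) (U : set 'cV[C]_p) :
  subspace U -> subspace (mulmx A @` U).
Proof.
move=> [U0 UD]; split; first by exists 0; rewrite ?mulmx0.
move=> a _ _ [u Uu <-] [v Uv <-]; exists (a *: u + v); first exact: UD.
by rewrite linearP.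
Qed.

Lemma subspace_mulmx_col n p (U : set 'cV[C]_n) (B : 'M[C]_(n, p)) (c : 'cV[C]_p) :
  subspace U -> (forall j, U (col j B)) -> U (B *m c).
Proof.
move=> sU UB; suff -> : B *m c = \sum_j c j 0 *: col j B.
  by apply: subspace_sum => // j _; apply: subspaceZ.
apply/colP => i; rewrite !mxE summxE; apply: eq_bigr => j _.
by rewrite !mxE mulrC.
Qed.

Lemma subspace_mulmx_row n p (U : set 'rV[C]_n) (B : 'M[C]_(p, n)) (c : 'rV[C]_p) :
  subspace U -> (forall j, U (row j B)) -> U (c *m B).
Proof.
move=> sU UB; rewrite mulmx_sum_row; by apply: subspace_sum => // j _; apply: subspaceZ.
Qed.

(** The columns of [B] form an independent family in [U] of maximal size; the rank bounds the size
    by [N], and a vector outside the span could be appended. *)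
Lemma subspace_basis N (U : set 'cV[C]_N) : subspace U ->
  exists (r : nat) (B : 'M[C]_(N, r)),
    (forall c : 'cV_r, B *m c = 0 -> c = 0) /\
    (forall u, U u <-> exists c, u = B *m c).
Proof.
move=> sU.
pose P r := exists B : 'M[C]_(N, r), (forall c : 'cV_r, B *m c = 0 -> c = 0) /\
  (forall c : 'cV_r, U (B *m c)).
have exP : exists r, `[< P r >].
  exists 0%N; apply/asboolP; exists 0; split=> c; first by rewrite [c]flatmx0.
  by rewrite mul0mx; case: sU.
have leP r : `[< P r >] -> (r <= N)%N.
  move=> /asboolP[B [Binj _]].
  have : row_free B^T.
    apply: inj_row_free => v vB; apply: trmx_inj; rewrite trmx0; apply: Binj.
    by rewrite -[B]trmxK -trmx_mul vB trmx0.
  by move=> /eqP <-; exact: rank_leq_col.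
case: (ex_maxnP exP leP) => r /asboolP[B [Binj UB]] maxr.
exists r, B; split=> // u; split=> [Uu|[c ->]] //.
apply: contrapT => nBu.
suff /asboolP/maxr : P (r + 1)%N by rewrite addn1 ltnn.
exists (row_mx B u); split=> c; rewrite -[c]vsubmxK mul_row_col; last first.
  have -> : u *m dsubmx c = dsubmx c 0 0 *: u.
    by rewrite {1}[dsubmx c]mx11_scalar mul_mx_scalar.
  by apply: subspaceD => //; apply: subspaceZ.
have -> : u *m dsubmx c = dsubmx c 0 0 *: u.
  by rewrite {1}[dsubmx c]mx11_scalar mul_mx_scalar.
(* The coefficient of the appended vector: if it were nonzero, [u] would be a combination of the
   columns of [B]. *)
set a := dsubmx c 0 0 => Bcu.
have a0 : a = 0.
  apply/eqP; case: (boolP (a == 0)) => // a0; case: nBu; exists (- a^-1 *: usubmx c).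
  rewrite -scalemxAr (_ : B *m _ = - (a *: u)); last by apply/eqP; rewrite -addr_eq0 Bcu.
  by rewrite scaleNr scalerN opprK scalerA mulVf // scale1r.
rewrite [dsubmx c]mx11_scalar -/a a0 raddf0.
by rewrite (Binj (usubmx c)) ?col_mx0 //; move: Bcu; rewrite a0 scale0r addr0.
Qed.

End Subspace.

Section HermitianForm.
Variable C : numClosedFieldType.
Local Notation "M ^~" := (map_mx Num.conj M) (at level 2, format "M ^~").

Definition gram_form N (G : 'M[C]_N) (u v : 'cV[C]_N) : C := (u^T *m G *m v^~) 0 0.

Definition posdef N (G : 'M[C]_N) := forall u, u != 0 -> 0 < gram_form G u u.

Section Form.
Variables (N : nat) (G : 'M[C]_N).
Implicit Types u v w : 'cV[C]_N.

Lemma gram_formDl a u v w :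
  gram_form G (a *: u + v) w = a * gram_form G u w + gram_form G v w.
Proof. by rewrite /gram_form linearP /= !mulmxDl -!scalemxAl !mxE. Qed.

Lemma gram_formBl u v w : gram_form G (u - v) w = gram_form G u w - gram_form G v w.
Proof. by rewrite /gram_form linearB /= !mulmxBl !mxE. Qed.

Lemma gram_form0l u : gram_form G 0 u = 0.
Proof. by rewrite /gram_form trmx0 !mul0mx mxE. Qed.

Lemma gram_formBr u v w : gram_form G w (u - v) = gram_form G w u - gram_form G w v.
Proof. by rewrite /gram_form map_mxB mulmxBr !mxE. Qed.

Lemma gram_form_suml (I : finType) (F : I -> 'cV[C]_N) w :
  gram_form G (\sum_i F i) w = \sum_i gram_form G (F i) w.
Proof.
rewrite /gram_form (raddf_sum trmx) /= !mulmx_suml summxE.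
by [].
Qed.

Hypothesis G_pos : posdef G.

Lemma posdef_eq0 u : gram_form G u u = 0 -> u = 0.
Proof. by apply: contra_eq => /G_pos/lt0r_neq0. Qed.

Lemma posdef_ge0 u : 0 <= gram_form G u u.
Proof.
by case: (eqVneq u 0) => [->|/G_pos/ltW//]; rewrite gram_form0l.
Qed.

Lemma posdef_unit : G \in unitmx.
Proof.
rewrite -row_free_unit; apply: inj_row_free => v vG.
apply: trmx_inj; rewrite trmx0; apply: posdef_eq0.
by rewrite /gram_form trmxK vG mul0mx mxE.
Qed.

Lemma gram_form_nondeg v : (forall u, gram_form G u v = 0) -> v = 0.
Proof. by move=> /(_ v)/posdef_eq0. Qed.

Lemma adjoint_mx_exists (D : 'M[C]_N) :
  exists Ds : 'M[C]_N, forall u v, gram_form G (D *m u) v = gram_form G u (Ds *m v).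
Proof.
(* The solution of [D^T *m G = G *m Ds^~]. *)
exists (invmx G *m D^T *m G)^~ => u v.
rewrite /gram_form map_mxM -map_mx_comp (map_mx_id (@conjCK _)) trmx_mul.
by rewrite !mulmxA mulmxK ?posdef_unit.
Qed.

(** In a basis [B] of [U] the coordinates of the projection solve a linear system whose matrix [W]
    is the Gram matrix of the basis, invertible because the form is definite on [U]. *)
Lemma orth_proj_exists (U : set 'cV[C]_N) v : subspace U ->
  exists2 p, U p & forall u, U u -> gram_form G (v - p) u = 0.
Proof.
move=> /subspace_basis[r [B [Binj UB]]].
pose W : 'M_r := B^T *m G *m B^~.
have uW : W \in unitmx.
  rewrite -row_free_unit; apply: inj_row_free => c cW.
  apply: trmx_inj; rewrite trmx0; apply: Binj; apply: posdef_eq0.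
  rewrite /gram_form trmx_mul trmxK map_mxM !mulmxA.
  by rewrite -(mulmxA c) -(mulmxA c) cW mul0mx mxE.
pose c := v^T *m G *m B^~ *m invmx W.
exists (B *m c^T); first by apply/UB; exists c^T.
move=> _ /UB[d ->]; rewrite gram_formBl /gram_form trmx_mul trmxK map_mxM.
rewrite !mulmxA -(mulmxA c) -(mulmxA c) -/W /c mulmxKV // subrr //.
Qed.

Lemma orth_proj_mx_exists (U : set 'cV[C]_N) : subspace U ->
  exists P : 'M[C]_N, forall v, U (P *m v) /\
    forall u, U u -> gram_form G (v - P *m v) u = 0.
Proof.
move=> sU.
have /choice[p pP] : forall j : 'I_N, exists p, U p /\
    forall u, U u -> gram_form G (delta_mx j 0 - p) u = 0.
  by move=> j; have [p Up pu] := orth_proj_exists (delta_mx j 0) sU; exists p.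
exists (\matrix_(i, j) p j i 0) => v.
have PE : (\matrix_(i, j) p j i 0) *m v = \sum_j v j 0 *: p j.
  apply/colP => i; rewrite mxE summxE; apply: eq_bigr => j _.
  by rewrite !mxE mulrC.
rewrite PE; split; first by apply: subspace_sum => // j _; apply: subspaceZ => //; case: (pP j).
move=> u Uu; rewrite {1}[v]matrix_sum_delta.
under eq_bigr do rewrite big_ord1.
rewrite -sumrB gram_form_suml big1 // => j _; rewrite -scalerBr.
rewrite -[_ *: _]addr0 gram_formDl gram_form0l addr0.
by case: (pP j) => _ ->; rewrite ?mulr0.
Qed.

End Form.

(** With [x = u^T *m A] the value of the form is the sum of the squares |x_i|^2. *)
Lemma unit_gram_posdef N (A : 'M[C]_N) : A \in unitmx -> posdef (A *m A^T^~).
Proof.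
move=> uA u u0; rewrite /gram_form mulmxA -mulmxA.
have -> : A^T^~ *m u^~ = ((u^T *m A)^T)^~.
  by rewrite trmx_mul trmxK map_mxM.
have : u^T *m A != 0.
  apply: contra u0 => /eqP uA0; apply/eqP/trmx_inj.
  by rewrite trmx0 -(mulmxK uA u^T) uA0 mul0mx.
move: (u^T *m A) => x /rV0Pn[i xi].
rewrite mxE (bigD1 i) //= !mxE; apply: ltr_wpDr.
  by apply: sumr_ge0 => j _; rewrite !mxE -normCK exprn_ge0.
by rewrite -normCK exprn_gt0 // normr_gt0.
Qed.

(** Diagonalise [M] by a unitary [P] and scale by the inverse square roots of the eigenvalues. The
    factorisation is stated for the inverse because [gram1] is an inverse Gram matrix. *)
Lemma posdef_inv_gram N (M : 'M[C]_N) : M^T^~ = M -> posdef M ->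
  exists2 A : 'M[C]_N, A \in unitmx & invmx M = A *m A^T^~.
Proof.
move=> hM pM.
have /orthomx_spectralP : M \is normalmx by apply/normalmxP; rewrite hM.
set P := spectralmx M; set d := spectral_diag M => ME.
have uP : P \is unitarymx by exact: spectral_unitarymx.
have UP : P \in unitmx by exact: spectral_unit.
have PME : P *m M *m P^T^~ = diag_mx d.
  by rewrite ME -invmx_unitary // !mulmxA mulmxV // mul1mx mulmxK.
(* An eigenvalue is the value of the form on the corresponding row of [P]. *)
have d_gt0 i : 0 < d 0 i.
  have /pM : (row i P)^T != 0.
    rewrite trmx_eq0; apply/eqP => Pi0.
    have /rowP/(_ i)/eqP : row i P *m invmx P = 0 by rewrite Pi0 mul0mx.
    by rewrite -row_mul mulmxV // !mxE eqxx oner_eq0.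
  rewrite /gram_form trmxK.
  have -> : row i P *m M *m ((row i P)^T)^~ = row i (P *m M) *m col i P^T^~.
    by rewrite row_mul; congr (_ *m _); apply/matrixP => j k; rewrite !mxE.
  suff -> : (row i (P *m M) *m col i P^T^~) 0 0 = d 0 i by [].
  move/matrixP/(_ i i): PME; rewrite !mxE eqxx mulr1n => <-.
  by apply: eq_bigr => j _; rewrite !mxE.
pose s := \row_i (sqrtC (d 0 i))^-1.
have s_real : s^~ = s.
  apply/rowP => i; rewrite !mxE conj_Creal // realV realE sqrtC_ge0.
  by rewrite ltW.
exists (invmx P *m diag_mx s).
  rewrite unitmx_mul unitmx_inv UP unitmxE det_diag unitfE.
  by apply/prodf_neq0 => i _; rewrite mxE invr_eq0 sqrtC_eq0 gt_eqF.
rewrite trmx_mul map_mxM tr_diag_mx map_diag_mx s_real.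
rewrite [in (invmx P)^T^~]invmx_unitary // trmxCK mulmxA -(mulmxA (invmx P)).
have ds : diag_mx s *m diag_mx s *m diag_mx d = 1%:M.
  rewrite !mulmx_diag -diag_const_mx; congr diag_mx; apply/rowP => i; rewrite !mxE.
  by rewrite -invfM -expr2 sqrtCK mulVf // gt_eqF.
suff: invmx P *m (diag_mx s *m diag_mx s) *m P *m M = 1%:M.
  move=> E; have uM : M \in unitmx by case/mulmx1_unit: E.
  by rewrite -[RHS](mulmxK uM) E mul1mx.
rewrite ME !mulmxA mulmxK // -!mulmxA.
by rewrite (mulmxA (diag_mx s)) (mulmxA (_ *m _)) ds mul1mx mulVmx.
Qed.

End HermitianForm.

(** * Hermitian products on forms and on g-valued forms *)

Section HermitianStructure.
Variables (R : realType) (n : nat).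
Local Notation C := (Cplx R).
Local Notation g := 'rV[C]_n.
Local Notation N := (ext_dim n).
Local Notation "M ^~" := (map_mx Num.conj M) (at level 2, format "M ^~").
Variable dotg : {dot g for Num.conj}.

Definition dot_mx : 'M[C]_n := \matrix_(i, j) dotg (delta_mx 0 i) (delta_mx 0 j).

Lemma dotE (x y : g) : dotg x y = (x *m dot_mx *m y^T^~) 0 0.
Proof.
rewrite {1}[x]row_sum_delta {1}[y]row_sum_delta linear_sumlz mxE.
under eq_bigr => i _ do rewrite linear_sumr.
rewrite exchange_big; apply: eq_bigr => j _; rewrite !mxE mulr_suml.
apply: eq_bigr => i _; by rewrite mxE linearZl_LR linearZr_LR /= mulrCA mulrC.
Qed.

Lemma dot_mx_herm : dot_mx^T^~ = dot_mx.
Proof.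
by apply/matrixP => i j; rewrite !mxE [RHS]hermC expr0 mul1r.
Qed.

Lemma dot_mx_posdef : posdef dot_mx.
Proof.
move=> u u0; rewrite /gram_form; have := dotE u^T u^T; rewrite trmxK => <-.
by apply: neq0_dnorm_gt0; rewrite trmx_eq0.
Qed.

Lemma dot_mx_sqrt : exists2 B : 'M[C]_n, B \in unitmx & dot_mx = B *m B^T^~.
Proof.
have [A uA AE] := posdef_inv_gram dot_mx_herm dot_mx_posdef.
have uAd : A^T^~ \in unitmx by rewrite map_unitmx unitmx_tr.
have AK : A^T^~^T^~ = A.
  by rewrite map_trmx trmxK -map_mx_comp (map_mx_id (@conjCK _)).
(* Inverting [invmx M = A *m A^T^~] exchanges the two factors. *)
exists (invmx A^T^~); first by rewrite unitmx_inv.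
have -> : (invmx A^T^~)^T^~ = invmx A by rewrite trmx_inv map_invmx AK.
rewrite -[RHS]mul1mx -(mulmxV (posdef_unit dot_mx_posdef)) AE !mulmxA.
by rewrite (mulmxK uAd) (mulmxK uA).
Qed.

Definition gram_mx : 'M[C]_N := compound_mx (gram1 dotg).

Lemma gram_mx_sqrt : exists2 D : 'M[C]_N, D \in unitmx & gram_mx = D *m D^T^~.
Proof.
have [A uA AE] := posdef_inv_gram dot_mx_herm dot_mx_posdef.
exists (compound_mx A); first exact: compound_mx_unit.
by rewrite /gram_mx /gram1 -/dot_mx AE compound_mxM compound_mx_map compound_mx_tr.
Qed.

Lemma gram_mx_posdef : posdef gram_mx.
Proof. by have [D uD ->] := gram_mx_sqrt; apply: unit_gram_posdef. Qed.

Lemma gram_mx_herm : gram_mx^T^~ = gram_mx.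
Proof.
have [D _ ->] := gram_mx_sqrt; rewrite trmx_mul map_mxM; congr (_ *m _).
by rewrite map_trmx trmxK -map_mx_comp (map_mx_id (@conjCK _)).
Qed.

Lemma gram_formC u v : gram_form gram_mx u v = (gram_form gram_mx v u)^*.
Proof.
transitivity ((v^T *m gram_mx *m u^~)^T^~ 0 0); last by rewrite mxE [_^T _ _]mxE.
rewrite /gram_form !trmx_mul trmxK !map_mxM gram_mx_herm mulmxA.
by rewrite map_trmx -map_mx_comp (map_mx_id (@conjCK _)).
Qed.

Lemma big_set_ord (F : 'I_N -> C) : \sum_(S : {set 'I_n}) F (enum_rank S) = \sum_i F i.
Proof. by rewrite [RHS](reindex _ (onW_bij _ (@enum_rank_bij _))). Qed.

Lemma gramE (S T : {set 'I_n}) : gram dotg S T = gram_mx (enum_rank S) (enum_rank T).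
Proof. by rewrite mxE !enum_rankK. Qed.

Lemma dot_formE u v : dot_form dotg u v = gram_form gram_mx u v.
Proof.
rewrite /gram_form mxE -big_set_ord.
under [RHS]eq_bigr => T _ do rewrite mxE mulr_suml -big_set_ord.
rewrite exchange_big; apply: eq_bigr => T _; apply: eq_bigr => S _.
by rewrite gramE !mxE; ring.
Qed.

Lemma dot_gformE T U : dot_gform dotg T U =
  \sum_i \sum_j gram_mx i j * (T *m dot_mx *m U^T^~) i j.
Proof.
rewrite -big_set_ord; apply: eq_bigr => S _.
rewrite -big_set_ord; apply: eq_bigr => S' _.
rewrite gramE dotE; congr (_ * _); rewrite !mxE; apply: eq_bigr => k _.
rewrite !mxE; congr (_ * _); apply: eq_bigr => l _; by rewrite !mxE.
Qed.

Lemma dot_gformDr T U V :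
  dot_gform dotg T (U + V) = dot_gform dotg T U + dot_gform dotg T V.
Proof.
rewrite !dot_gformE -big_split; apply: eq_bigr => i _.
rewrite -big_split; apply: eq_bigr => j _ /=.
by rewrite linearD map_mxD mulmxDr [X in _ * X = _]mxE mulrDr.
Qed.

Lemma dot_gformBl T U V :
  dot_gform dotg (T - U) V = dot_gform dotg T V - dot_gform dotg U V.
Proof.
rewrite !dot_gformE -sumrB; apply: eq_bigr => i _.
rewrite -sumrB; apply: eq_bigr => j _ /=.
by rewrite !mulmxBl [X in _ * X = _]mxE [X in _ * (_ + X) = _]mxE mulrBr.
Qed.

Lemma dot_gform0r T : dot_gform dotg T 0 = 0.
Proof. by apply: (addrI (dot_gform dotg T 0)); rewrite -dot_gformDr !addr0. Qed.

(** Contracting the g factor of [T] with [y] leaves an ordinary form; orthogonality to a pure tensor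
    is thereby tested in the exterior algebra. *)
Lemma dot_gform_mulr T (b : 'cV[C]_N) (y : g) :
  dot_gform dotg T (b *m y) = gram_form gram_mx (T *m dot_mx *m y^T^~) b.
Proof.
rewrite dot_gformE /gram_form trmx_mul map_mxM mulmxA.
move: (T *m _ *m _) => v; rewrite exchange_big mxE; apply: eq_bigr => j _.
rewrite !mxE mulr_suml; apply: eq_bigr => i _.
by rewrite !mxE big_ord1 !mxE mulrCA mulrA.
Qed.

(** Right multiplication by a square root [B] of [dot_mx] passes to orthonormal coordinates on g, in
    which the product splits over the columns. *)
Lemma dot_gform_sum_cols : exists2 B : 'M[C]_n, B \in unitmx & forall T,
  dot_gform dotg T T = \sum_l gram_form gram_mx (col l (T *m B)) (col l (T *m B)).
Proof.
have [B uB BE] := dot_mx_sqrt; exists B => // T.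
rewrite dot_gformE BE mulmxA -mulmxA -map_mxM -trmx_mul.
move: (T *m B) => X; rewrite /gram_form.
under [RHS]eq_bigr => l _ do
  (rewrite mxE; under eq_bigr => j _ do rewrite mxE mulr_suml).
rewrite exchange_big /= [RHS]exchange_big /=; apply: eq_bigr => j _.
rewrite [RHS]exchange_big /=; apply: eq_bigr => i _.
rewrite [X in _ * X]mxE mulr_sumr; apply: eq_bigr => l _; rewrite !mxE.
by ring.
Qed.

Lemma dot_gform_ge0 T : 0 <= dot_gform dotg T T.
Proof.
have [B _ ->] := dot_gform_sum_cols; apply: sumr_ge0 => l _.
exact/posdef_ge0/gram_mx_posdef.
Qed.

Lemma dot_gform_eq0 T : dot_gform dotg T T = 0 -> T = 0.
Proof.
have [B uB ->] := dot_gform_sum_cols => /eqP; rewrite psumr_eq0; last first.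
  by move=> l _; exact/posdef_ge0/gram_mx_posdef.
move=> /allP TB; suff TB0 : T *m B = 0 by rewrite -(mulmxK uB T) TB0 mul0mx.
apply/matrixP => i l; have /eqP/(posdef_eq0 gram_mx_posdef)/colP/(_ i) := TB l (mem_index_enum l).
by rewrite !mxE.
Qed.

End HermitianStructure.

(** * Tensor products of subspaces as conditions on rows and columns *)

Section Tensors.
Variable R : realType.
Local Notation C := (Cplx R).

(** The transpose of the orthogonal projection for the standard hermitian form: vectors of g are
    rows, so it acts on the right. *)
Lemma subspace_projector n (U : set 'rV[C]_n) : subspace U ->
  exists Q : 'M[C]_n, (forall x, U (x *m Q)) /\ (forall x, U x -> x *m Q = x).
Proof.
move=> sU; pose U' : set 'cV[C]_n := [set v | U v^T].
have sU' : subspace U'.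
  split; first by rewrite /U' /= trmx0; case: sU.
  by move=> a u v Uu Uv; rewrite /U' /= linearP; case: sU => _; apply.
have p1 : posdef (1%:M : 'M[C]_n).
  rewrite -(mulmx1 1%:M) -{2}(map_mx1 Num.conj) -{2}trmx1.
  by apply: unit_gram_posdef; rewrite unitmx1.
have [P PU] := orth_proj_mx_exists p1 sU'.
exists P^T; split=> [x|x Ux].
  by have [+ _] := PU x^T; rewrite /U' /= trmx_mul trmxK.
have Ux' : U' x^T by rewrite /U' /= trmxK.
have [Px Px_orth] := PU x^T; apply: trmx_inj; rewrite trmx_mul trmxK.
apply/esym/subr0_eq/(posdef_eq0 p1)/Px_orth.
exact: subspaceB.
Qed.

(** If the rows of [T] lie in [B] then [T = T *m Q] for a projector [Q] onto [B], and expanding this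
    product as a sum of columns times rows exhibits the pure tensors. *)
Lemma tensP p q (A : set 'cV[C]_p) (B : set 'rV[C]_q) (T : 'M[C]_(p, q)) :
  subspace A -> subspace B ->
  tens A B T <-> (forall j, A (col j T)) /\ (forall i, B (row i T)).
Proof.
move=> sA sB; split=> [[k [c [z [zAB ->]]]]|[TA TB]].
  split=> j; rewrite linear_sum; under eq_bigr do rewrite linearZ /=; apply: subspace_sum => // i _;
    apply: subspaceZ => //; have [a Aa [b Bb ->]] := zAB i.
  - rewrite (_ : col j _ = b 0 j *: a).
      exact: subspaceZ.
    by apply/colP => l; rewrite !mxE big_ord1 mulrC.
  - rewrite (_ : row j _ = a j 0 *: b).
      exact: subspaceZ.
    by apply/rowP => l; rewrite !mxE big_ord1.
have [Q [QB QE]] := subspace_projector sB.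
exists q, (fun=> 1), (fun j => col j T *m row j Q); split.
  move=> j; exists (col j T) => //; exists (row j Q) => //.
  by rewrite rowE; apply: QB.
have TQ : T *m Q = T by apply/row_matrixP => i; rewrite row_mul QE.
apply/matrixP => i j; rewrite -[in LHS]TQ mxE summxE; apply: eq_bigr => l _.
by rewrite scale1r !mxE big_ord1 !mxE.
Qed.

Lemma tensTP p q (A : set 'cV[C]_p) (T : 'M[C]_(p, q)) :
  subspace A -> tens A setT T <-> forall j, A (col j T).
Proof.
move=> sA; have := tensP T sA (subspaceT _) => ->; by split=> [[]|].
Qed.

Lemma tensT_mulr p q r (A : set 'cV[C]_p) (T : 'M[C]_(p, q)) (B : 'M_(q, r)) :
  subspace A -> tens A setT T -> tens A setT (T *m B).
Proof.
move=> sA /tensTP-/(_ sA) TA; apply/tensTP => // j; rewrite colE -mulmxA.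
exact: subspace_mulmx_col.
Qed.

End Tensors.

(** * Degrees of forms and the matrix of [dbar] *)

Section Forms.
Variables (R : realType) (n : nat).
Local Notation C := (Cplx R).
Local Notation g := 'rV[C]_n.
Local Notation N := (ext_dim n).

Lemma LamP k (w : 'cV[C]_N) :
  Lam k w <-> forall S : {set 'I_n}, #|S| != k -> w (enum_rank S) 0 = 0.
Proof.
split=> wk S Sk; first by have /rowP/(_ 0) := wk S Sk; rewrite !mxE.
by apply/rowP => i; rewrite !mxE ord1 wk.
Qed.

Lemma Lam_subspace k : subspace (@Lam R n k).
Proof.
split; first by apply/LamP => S _; rewrite mxE.
move=> a u v /LamP uk /LamP vk; apply/LamP => S Sk.
by rewrite !mxE uk // vk // mulr0 addr0.
Qed.

Lemma mono_Lam (S : {set 'I_n}) : Lam #|S| (mono R S).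
Proof.
apply/LamP => T TS; rewrite mxE eqxx andbT.
by case: eqP => // /enum_rank_inj TE; rewrite TE eqxx in TS.
Qed.

Lemma monoE (S T : {set 'I_n}) : mono R S (enum_rank T) 0 = (T == S)%:R.
Proof. by rewrite mxE eqxx andbT (inj_eq enum_rank_inj). Qed.

Lemma coefE p (T : 'M[C]_(N, p)) S j : coef T S 0 j = T (enum_rank S) j.
Proof. by rewrite mxE. Qed.

Lemma mono_wedge_Lam (S T : {set 'I_n}) : Lam (#|S| + #|T|) (mono_wedge R S T).
Proof.
rewrite /mono_wedge; case: ifP => dST; last by case: (Lam_subspace (#|S| + #|T|)).
have <- : #|S :|: T| = (#|S| + #|T|)%N.
  by rewrite cardsU disjoint_setI0 // cards0 subn0.
exact: (subspaceZ _ (@Lam_subspace _) (@mono_Lam _)).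
Qed.

Lemma wedge_Lam k l u v : Lam k u -> Lam l v -> Lam (k + l) (@wedge R n u v).
Proof.
move=> /LamP uk /LamP vl; have sL := @Lam_subspace (k + l).
apply: subspace_sum => // S _; apply: subspace_sum => // T _; rewrite !coefE.
case: (eqVneq #|S| k) => [Sk|/uk ->]; last by rewrite mul0r scale0r; case: sL.
case: (eqVneq #|T| l) => [Tl|/vl ->]; last by rewrite mulr0 scale0r; case: sL.
by apply: (subspaceZ _ sL); rewrite -Sk -Tl; apply: mono_wedge_Lam.
Qed.

Lemma wedge_mono0 (u : 'cV[C]_N) : wedge u (mono R finset.set0) = u.
Proof.
have wE S : \sum_(T : {set 'I_n})
    (coef u S 0 0 * coef (mono R finset.set0) T 0 0) *: mono_wedge R S T =
    u (enum_rank S) 0 *: mono R S.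
  rewrite (bigD1 finset.set0) //= big1 ?addr0; last first.
    by move=> T T0; rewrite !coefE monoE (negPf T0) mulr0 scale0r.
  rewrite !coefE monoE eqxx mulr1 /mono_wedge finset.setU0 -setI_eq0 finset.setI0 eqxx.
  rewrite [X in _ ^+ X]eq_card0 ?scale1r // => ij.
  by apply/negP => /asboolP; rewrite /= inE /= andbF.
rewrite /wedge (eq_bigr _ (fun S _ => wE S)).
apply/colP => r; rewrite summxE -[r]enum_valK.
rewrite (bigD1 (enum_val r)) //= big1 ?addr0; last first.
  by move=> S Si; rewrite mxE monoE eq_sym (negPf Si) mulr0.
by rewrite mxE monoE eqxx mulr1.
Qed.

Section Bracket.
Variable br : {bilinear g -> g -> g}.

Lemma dbar_gen_Lam i : Lam 2 (dbar_gen br i).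
Proof.
have sL := @Lam_subspace 2; apply: subspace_sum => // j _.
apply: subspace_sum => // k jk; apply: (subspaceZ _ sL).
have <- : #|[set j; k]%SET| = 2%N by rewrite cards2 neq_ltn jk.
exact: mono_Lam.
Qed.

Lemma dbar_mono_Lam (S : {set 'I_n}) : Lam #|S|.+1 (dbar_mono br S).
Proof.
have sL := @Lam_subspace #|S|.+1; apply: subspace_sum => // i iS.
apply: (subspaceZ _ sL).
have -> : #|S|.+1 = (2 + #|S :\ i|)%N by rewrite (cardsD1 i S) iS.
by apply: wedge_Lam; [exact: dbar_gen_Lam|exact: mono_Lam].
Qed.

Definition dbar_mx : 'M[C]_N := \matrix_(i, j) dbar_mono br (enum_val j) i 0.

Lemma dbarE p (T : 'M[C]_(N, p)) : dbar br T = dbar_mx *m T.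
Proof.
apply/matrixP => i j; rewrite summxE mxE -big_set_ord; apply: eq_bigr => S _.
by rewrite !mxE big_ord1 enum_rankK !mxE.
Qed.

(** The counterpart of [dbar_mx_Lam] for forms without component in degree [k]; by duality it shows
    that the adjoint lowers the degree by one. *)
Lemma dbar_mx_shift k l (w : 'cV[C]_N) :
  (forall S : {set 'I_n}, #|S| = k -> w (enum_rank S) 0 = 0) ->
  l = k.+1 ->
  forall S : {set 'I_n}, #|S| = l -> (dbar_mx *m w) (enum_rank S) 0 = 0.
Proof.
move=> wk -> S Sk; rewrite mxE -big_set_ord big1 // => T _; rewrite mxE enum_rankK.
case: (eqVneq #|T| k) => [/wk->|Tk]; first by rewrite mulr0.
by have /LamP -> := @dbar_mono_Lam T; rewrite ?mul0r // Sk eqSS eq_sym.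
Qed.

Lemma dbar_mx_Lam k (w : 'cV[C]_N) : Lam k w -> Lam k.+1 (dbar_mx *m w).
Proof.
move=> /LamP wk; apply/LamP => S Sk.
rewrite mxE -big_set_ord big1 // => T _; rewrite mxE enum_rankK.
case: (eqVneq #|T| k) => [Tk|/wk->]; last by rewrite mulr0.
by have /LamP -> := @dbar_mono_Lam T; rewrite ?mul0r // Tk.
Qed.

End Bracket.
End Forms.
(** * Hodge decomposition *)

Section Hodge.
Variables (R : realType) (n : nat).
Local Notation C := (Cplx R).
Local Notation g := 'rV[C]_n.
Local Notation N := (ext_dim n).
Local Notation "M ^~" := (map_mx Num.conj M) (at level 2, format "M ^~").
Variables (br : {bilinear g -> g -> g}) (dotg : {dot g for Num.conj}).
Local Notation form := (gram_form (gram_mx dotg)).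
Local Notation D := (dbar_mx br).
Let Gpos := gram_mx_posdef dotg.

(** Projecting the form factor column by column is orthogonal to pure tensors, hence to all of
    [tens U setT]. The choice made by [orth_proj] agrees with it, since their difference lies in
    this subspace and is orthogonal to it. *)
Lemma orth_proj_tens (U : set 'cV[C]_N) : subspace U ->
  exists P : 'M[C]_N, (forall v, U (P *m v)) /\
    forall T, orth_proj (dot_gform dotg) (tens U setT) T = P *m T.
Proof.
move=> sU; have [P PU] := orth_proj_mx_exists Gpos sU.
exists P; split=> [v|T]; first by case: (PU v).
have UPT : tens U setT (P *m T).
  by apply/tensTP => // j; rewrite colE -mulmxA -colE; case: (PU (col j T)).
have orthPT u : tens U setT u -> dot_gform dotg (T - P *m T) u = 0.
  move=> /tensTP-/(_ sU) Uu.
  have -> : u = \sum_j col j u *m delta_mx 0 j.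
    apply/matrixP => i j; rewrite summxE (bigD1 j) //= big1 ?addr0.
      by rewrite !mxE big_ord1 !mxE !eqxx mulr1.
    by move=> k kj; rewrite !mxE big_ord1 !mxE eqxx eq_sym (negPf kj) mulr0.
  rewrite (big_morph _ (dot_gformDr _ _) (dot_gform0r _ _)) big1 // => j _.
  rewrite dot_gform_mulr !mulmxBl -!mulmxA.
  by case: (PU (T *m (dot_mx dotg *m (delta_mx 0 j)^T^~))) => _; apply.
apply: xget_unique; first by split.
move=> p [Up p_orth]; apply/subr0_eq/(@dot_gform_eq0 _ _ dotg).
have dE : p - P *m T = (T - P *m T) - (T - p) by rewrite opprB [RHS]addrC subrKA.
have Ud : tens U setT (p - P *m T).
  apply/tensTP => // j; rewrite linearB.
  by apply: (subspaceB sU); apply: (tensTP _ sU).1.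
by rewrite {1}dE dot_gformBl orthPT // p_orth // subrr.
Qed.

Lemma dbar_star_mx_exists : exists Ds : 'M[C]_N,
  dbar_star br dotg = mulmx Ds /\ forall u v, form (D *m u) v = form u (Ds *m v).
Proof.
have [Ds DsP] := adjoint_mx_exists Gpos D; exists Ds; split=> //.
apply/funext => v; apply: xget_unique => [u|w wP].
  by rewrite !dot_formE dbarE DsP.
apply/subr0_eq/(gram_form_nondeg Gpos) => u.
by rewrite gram_formBr -DsP -dbarE -!dot_formE wP subrr.
Qed.

Lemma exact_subspace k : subspace (exact_forms br k).
Proof.
rewrite /exact_forms (_ : @dbar R n br 1 = mulmx D); last by apply/funext => u; rewrite dbarE.
exact/subspace_image_mulmx/Lam_subspace.
Qed.

Lemma coexact_subspace k : subspace (coexact_forms br dotg k).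
Proof.
have [Ds [E _]] := dbar_star_mx_exists; rewrite /coexact_forms E.
exact/subspace_image_mulmx/Lam_subspace.
Qed.

Lemma laplacian_mx_exists : exists L : 'M[C]_N, laplacian br dotg = mulmx L.
Proof.
have [Ds [E _]] := dbar_star_mx_exists; exists (D *m Ds + Ds *m D).
by apply/funext => u; rewrite /laplacian E !dbarE mulmxDl !mulmxA.
Qed.

Lemma harmonic_subspace k : subspace (harmonic_forms br dotg k).
Proof.
have [L0 LD] := @Lam_subspace R n k; have [L E] := laplacian_mx_exists.
rewrite /harmonic_forms E; split; first by split=> //=; rewrite mulmx0.
move=> a u v [uk /= Lu] [vk /= Lv]; split; first exact: LD.
by rewrite /= linearP /= Lu Lv scaler0 addr0.
Qed.

(** Pairing the Laplacian of [u] with [u] gives the sum of the squared norms of [D *m u] and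
    [Ds *m u]. *)
Lemma harmonic_closed k u : harmonic_forms br dotg k u -> D *m u = 0.
Proof.
have [Ds [E DsP]] := dbar_star_mx_exists.
rewrite /harmonic_forms /laplacian E => -[_ /=]; rewrite !dbarE => Lu.
apply: (posdef_eq0 Gpos); apply/eqP; rewrite eq_le posdef_ge0 // andbT.
have : form (D *m (Ds *m u) + Ds *m (D *m u)) u = 0 by rewrite Lu gram_form0l.
rewrite -[X in form (X + _)]scale1r gram_formDl mul1r DsP.
rewrite [form (Ds *m (D *m u)) u]gram_formC -(DsP u) => /eqP.
by rewrite addr_eq0 -gram_formC => /eqP EE; rewrite -oppr_ge0 -EE posdef_ge0.
Qed.

(** Let [q] be [v] without its degree [k] part. Then <q, q> = <q, v> as distinct degrees are
    orthogonal, and <q, v> = <D q, w> vanishes because D q has no component in degree k + 1, where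
    [w] lives. *)
Lemma coexact_Lam k v : coexact_forms br dotg k v -> Lam k v.
Proof.
have [Ds [E DsP]] := dbar_star_mx_exists.
rewrite /coexact_forms E => -[w /LamP wk vE]; apply/LamP.
pose q : 'cV[C]_N := \col_i (if #|(enum_val i : {set 'I_n})| == k then 0 else v i 0).
suff q0 : q = 0.
  move=> S Sk; move/colP/(_ (enum_rank S)): q0.
  by rewrite !mxE enum_rankK (negPf Sk).
have orth0 (x y : 'cV[C]_N) l :
    (forall S : {set 'I_n}, #|S| = l -> x (enum_rank S) 0 = 0) ->
    (forall S : {set 'I_n}, #|S| != l -> y (enum_rank S) 0 = 0) -> form x y = 0.
  move=> xl yl; rewrite -dot_formE /dot_form big1 // => S _; rewrite big1 // => T _.
  rewrite !coefE; case: (eqVneq #|T| l) => [Tl|/yl->]; last by rewrite conjC0 !mulr0.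
  case: (eqVneq #|S| l) => [/xl->|Sl]; first by rewrite mul0r mulr0.
  by rewrite gramE mxE !enum_rankK minor_card ?mul0r // Tl; apply/eqP.
have qk (S : {set 'I_n}) : #|S| = k -> q (enum_rank S) 0 = 0.
  by move=> Sk; rewrite mxE enum_rankK Sk eqxx.
apply: (posdef_eq0 Gpos).
have -> : form q q = form q v - form q (v - q).
  by rewrite -gram_formBr opprB addrC subrK.
rewrite (orth0 q (v - q) k) // ?subr0; last first.
  by move=> S /negPf Sk; rewrite !mxE enum_rankK Sk subrr.
rewrite -vE -DsP; apply: (orth0 _ _ k.+1) => //.
exact: (dbar_mx_shift br qk erefl).
Qed.

(** The image of an adjoint is orthogonal to the kernel. *)
Lemma coexact_closed_eq0 k v : coexact_forms br dotg k v -> D *m v = 0 -> v = 0.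
Proof.
have [Ds [E DsP]] := dbar_star_mx_exists.
rewrite /coexact_forms E => -[w _ <-] Dv; apply: (posdef_eq0 Gpos).
by rewrite -DsP Dv gram_form0l.
Qed.

(** Take for [v] the projection of [u] onto the coexact forms: the squared norm of D (u - v) is the
    product of u - v with the coexact form Ds D (u - v), which is 0. For k = 1 this says that [dbar]
    maps V^1 onto B^2. *)
Lemma exact_coexact_exists k u : Lam k u ->
  exists2 v, coexact_forms br dotg k v & D *m v = D *m u.
Proof.
move=> uk; have [v Vv v_orth] := orth_proj_exists Gpos u (coexact_subspace k).
exists v => //; apply/esym/subr0_eq; rewrite -mulmxBr.
have uvk : Lam k.+1 (D *m (u - v)).
  by apply/dbar_mx_Lam/(subspaceB (@Lam_subspace _ _ _)) => //; apply: coexact_Lam.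
apply: (posdef_eq0 Gpos); have [Ds [E DsP]] := dbar_star_mx_exists.
by rewrite DsP v_orth // /coexact_forms E; exists (D *m (u - v)).
Qed.

(* The operators of the Kuranishi recursion act on the form factor only, hence
   as left multiplications that do not touch the coefficients in g. *)
Lemma hodge_operators : exists Ph K : 'M[C]_N,
  [/\ (forall T, projH br dotg T = Ph *m T),
      (forall T, delta br dotg (projB br dotg T) = K *m T) &
      (forall u, coexact_forms br dotg 1 (K *m u))].
Proof.
have [Ph [_ PhE]] := orth_proj_tens (harmonic_subspace 2).
have [Pb [Pb2 PbE]] := orth_proj_tens (exact_subspace 2).
have sV := coexact_subspace 1.
have /choice[v vP] : forall j : 'I_N, exists v,
    coexact_forms br dotg 1 v /\ D *m v = col j Pb.
  move=> j; have [u u1 <-] : exact_forms br 2 (col j Pb) by rewrite colE; apply: Pb2.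
  by have [v Vv DvE] := exact_coexact_exists u1; exists v; rewrite dbarE.
(* Column by column, a coexact primitive of the projection to B^2. *)
pose K := \matrix_(i, j) v j i 0.
have colK j : col j K = v j by apply/colP => i; rewrite !mxE.
have VK u : coexact_forms br dotg 1 (K *m u).
  by apply: subspace_mulmx_col => // j; rewrite colK; case: (vP j).
have DK : D *m K = Pb.
  by apply/eq_cols => j; rewrite colE -mulmxA -colE colK; case: (vP j).
exists Ph, K; split=> // T; rewrite [projB _ _ _]PbE; apply: xget_unique.
  split; last by rewrite dbarE mulmxA DK.
  by apply/tensTP => // j; rewrite colE -mulmxA; apply: VK.
(* Any other value of [delta] differs from [K *m T] by columns that are both coexact and closed. *)
move=> w [/tensTP-/(_ sV) Vw]; rewrite dbarE => Dw; apply/subr0_eq/eq_cols => j.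
rewrite [RHS]col0; apply: coexact_closed_eq0.
  rewrite linearB; apply: (subspaceB sV); first exact: Vw.
  by rewrite /= colE -mulmxA; apply: VK.
by rewrite colE mulmxA mulmxBr Dw mulmxA DK subrr mul0mx.
Qed.

End Hodge.
(** * The Kuranishi series *)

Section SpanSet.
Variables (R : realType) (V : lmodType (Cplx R)) (S : set V).

Lemma mem_span v : S v -> span_set S v.
Proof. by move=> Sv; exists 1%N, (fun=> 1), (fun=> v); rewrite big_ord1 scale1r. Qed.

Lemma span_subspace : subspace (span_set S).
Proof.
split; first by exists 0%N, (fun=> 0), (fun=> 0); split; [case|rewrite big_ord0].
move=> c _ _ [k [a [u [Su ->]]]] [l [b [w [Sw ->]]]].
exists (k + l)%N, (fun i => match split i with inl j => c * a j | inr j => b j end),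
  (fun i => match split i with inl j => u j | inr j => w j end).
split=> [i|]; first by case: split.
rewrite big_split_ord scaler_sumr; congr (_ + _); apply: eq_bigr => i _.
  by rewrite (unsplitK (inl i)) scalerA.
by rewrite (unsplitK (inr i)).
Qed.

End SpanSet.

Section Kuranishi.
Variables (R : realType) (n : nat).
Local Notation C := (Cplx R).
Local Notation g := 'rV[C]_n.
Local Notation N := (ext_dim n).
Variables (br : {bilinear g -> g -> g}) (dotg : {dot g for Num.conj}).
Hypothesis br_alt : forall x, br x x = 0.
Local Notation Phi_ := (Phi_ br dotg).

Lemma br_anti x y : br x y = - br y x.
Proof.
have /eqP := br_alt (x + y); rewrite linearDl !linearDr !br_alt add0r addr0.
by rewrite addr_eq0 => /eqP.
Qed.

Lemma lie_centre_subspace : subspace (lie_centre br).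
Proof.
split=> [x|a u v zu zv x]; first by rewrite linear0r.
by rewrite linearPr zu zv scaler0 addr0.
Qed.

Lemma lower_central_subspace k : subspace (lower_central br k).
Proof. by case: k => [|k]; [exact: subspaceT|exact: span_subspace]. Qed.

Lemma lower_central_brl k x y : lower_central br k x -> lower_central br k.+1 (br x y).
Proof.
move=> xk; rewrite br_anti -scaleN1r; apply: (subspaceZ _ (span_subspace _)).
by apply: mem_span; exists y; exists x.
Qed.

Lemma lower_central_brr k x y : lower_central br k y -> lower_central br k.+1 (br x y).
Proof. by move=> yk; apply: mem_span; exists x; exists y. Qed.

Lemma schouten_rows (W : set g) (T U : 'M[C]_(N, n)) : subspace W ->
  (forall i j, W (br (row i T) (row j U))) -> forall r, W (row r (schouten br T U)).
Proof.
move=> sW Wbr r; rewrite /schouten linear_sum; apply: subspace_sum => // i _.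
rewrite linear_sum; apply: subspace_sum => // j _ /=.
rewrite row_mul (mx11_scalar (row r _)) mul_scalar_mx.
exact: (subspaceZ _ sW (Wbr _ _)).
Qed.

Lemma eq_schouten (T U T' U' : 'M[C]_(N, n)) :
  (forall i j, br (row i T) (row j U) = br (row i T') (row j U')) ->
  schouten br T U = schouten br T' U'.
Proof.
by move=> E; apply: eq_bigr => i _; apply: eq_bigr => j _; rewrite /coef E.
Qed.

Lemma schouten_eq0 (T U : 'M[C]_(N, n)) :
  (forall i j, br (row i T) (row j U) = 0) -> schouten br T U = 0.
Proof.
move=> E; rewrite /schouten big1 // => i _; rewrite big1 // => j _.
by rewrite /coef E mulmx0.
Qed.

Lemma br_centre x y x' y' : lie_centre br (x - x') -> lie_centre br (y - y') ->
  br x y = br x' y'.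
Proof.
move=> zx zy; transitivity (br x' y); apply/subr0_eq; last by rewrite -linearBr zy.
by rewrite -linearBl br_anti zx oppr0.
Qed.

(* In [Phi_i, Phi_(k - i)] one of the two indices is at least k / 2, so that
   the depth in the lower central series grows at least like log2 k. *)
Lemma Phi_lower_central (K : 'M[C]_N) m k mu r :
  (forall T, delta br dotg (projB br dotg T) = K *m T) ->
  (2 ^ m <= k)%N -> lower_central br m (row r (Phi_ mu k)).
Proof.
move=> KE; elim: m k r => [//|m IHm] k r mk.
have k2 : (2 <= k)%N by apply: leq_trans mk; rewrite expnS leq_pmulr ?expn_gt0.
have sW := lower_central_subspace m.+1.
rewrite Phi_rec // KE -mulmxN row_mul; apply: (subspace_mulmx_row _ sW) => j.
rewrite linearN /= -scaleN1r; apply: (subspaceZ _ sW).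
rewrite linear_sum big_nat; apply: subspace_sum => // i /andP[i1 ik] /=.
apply: schouten_rows => // a b.
have [mi|im] := leqP (2 ^ m) i; first exact/lower_central_brl/IHm.
apply/lower_central_brr/IHm; rewrite leq_subRL ?(ltnW ik) //.
by apply: leq_trans mk; rewrite expnS mul2n -addnn leq_add2r ltnW.
Qed.

Lemma Phi_finite : nilpotent_lie br -> exists M, (2 <= M)%N /\
  forall mu k, (M <= k)%N -> Phi_ mu k = 0.
Proof.
have [Ph [K [_ KE _]]] := hodge_operators br dotg.
(* Depth [m] is already reached at 2 ^ m; the extra factor 2 keeps the bound at least 2 when m =
   0. *)
move=> [m m0]; exists (2 ^ m.+1)%N; split; first by rewrite expnS leq_pmulr ?expn_gt0.
move=> mu k mk; apply/row_matrixP => r; rewrite row0.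
apply: m0; apply: Phi_lower_central KE _; apply: leq_trans mk.
by rewrite leq_exp2l.
Qed.

Lemma Phi_sum M mu : (forall k, (M <= k)%N -> Phi_ mu k = 0) ->
  Phi br dotg mu = \sum_(0 <= k < M) Phi_ mu k.
Proof.
move=> Phi0; apply: lim_near_cst; first exact: norm_hausdorff.
exists M => // k /= Mk; rewrite /series /= (big_cat_nat (leq0n M) Mk) /=.
have -> : \sum_(M <= i < k) Phi_ mu i = 0.
  by rewrite big_nat big1 // => i /andP[/Phi0].
by rewrite addr0.
Qed.

(** [Phi_ mu 1] is [mu], and every later term is a value of [delta]. *)
Lemma Phi_sub_coexact mu : nilpotent_lie br ->
  tens (coexact_forms br dotg 1) setT (Phi br dotg mu - mu).
Proof.
have [Ph [K [_ KE VK]]] := hodge_operators br dotg.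
move=> /Phi_finite[M [M2 /(_ mu) PhiM]]; rewrite (Phi_sum PhiM).
have sV := coexact_subspace br dotg 1.
rewrite big_ltn ?(ltnW M2) // big_ltn // Phi_1 add0r addrC addKr.
apply/tensTP => // j; rewrite linear_sum big_nat; apply: subspace_sum => // k /andP[k2 _] /=.
by rewrite Phi_rec // KE -mulmxN colE -mulmxA.
Qed.

Lemma Phi_centre mu k : (forall r, lie_centre br (row r mu)) -> (2 <= k)%N ->
  Phi_ mu k = 0.
Proof.
have [Ph [K [_ KE _]]] := hodge_operators br dotg.
move=> zmu; elim/ltn_ind: k => k IHk k2; rewrite Phi_rec // KE.
rewrite big_nat big1 ?mulmx0 ?oppr0 // => i /andP[i1 ik].
apply: schouten_eq0 => a b.
(* The left factor is zero by induction when i > 1, and is the central [mu] when i = 1. *)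
case: (ltngtP i 1%N) i1 => // [i2|->] _.
  by rewrite IHk // row0 linear0l.
by rewrite Phi_1 br_anti zmu oppr0.
Qed.

Lemma Phi_centreE mu : (forall r, lie_centre br (row r mu)) -> Phi br dotg mu = mu.
Proof.
move=> zmu; rewrite (@Phi_sum 2); last by move=> k; apply: Phi_centre.
have Phi0 : Phi_ mu 0 = 0 by [].
by rewrite !big_nat_recr //= big_geq // Phi_1 Phi0 !add0r.
Qed.

(** Brackets do not see central differences, so from index 2 on the two series even have equal
    terms. *)
Lemma Phi_shift mu mu' k r : (forall r, lie_centre br (row r mu - row r mu')) ->
  lie_centre br (row r (Phi_ mu k) - row r (Phi_ mu' k)).
Proof.
have [Ph [K [_ KE _]]] := hodge_operators br dotg.
move=> zmu; elim/ltn_ind: k r => -[|[|k]] IHk r.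
- by rewrite subrr; case: lie_centre_subspace.
- exact: zmu.
suff -> : Phi_ mu k.+2 = Phi_ mu' k.+2 by rewrite subrr; case: lie_centre_subspace.
have k2 : (2 <= k.+2)%N by [].
rewrite [LHS](Phi_rec br dotg mu k2) [RHS](Phi_rec br dotg mu' k2) [in LHS]KE [in RHS]KE.
congr (- _); congr (K *m _); apply: eq_big_nat => i /andP[i1 ik].
by apply: eq_schouten => a b; apply: br_centre; apply: IHk => //; rewrite ltn_subrL i1.
Qed.

Lemma obs_shift mu mu' : nilpotent_lie br ->
  (forall r, lie_centre br (row r mu - row r mu')) -> obs br dotg mu = obs br dotg mu'.
Proof.
move=> /Phi_finite[M [_ PhiM]] zmu; rewrite /obs; congr projH.
have zPhi r : lie_centre br (row r (Phi br dotg mu) - row r (Phi br dotg mu')).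
  rewrite !(@Phi_sum M) => [|k|k]; try exact: PhiM.
  rewrite -linearB -sumrB linear_sum; apply: subspace_sum => [|k _].
    exact: lie_centre_subspace.
  by rewrite linearB; apply: Phi_shift.
by apply: eq_schouten => a b; apply: br_centre.
Qed.

End Kuranishi.
(** * Holomorphy and the cylinder structure *)

Section Holomorphic.
Variables (R : realType) (p q : nat).
Local Notation C := (Cplx R).
Local Notation E := 'M[C]_(p, q).

Definition holo (f : E -> C) := forall x, differentiable f x.
Definition holo_mx r s (F : E -> 'M[C]_(r, s)) := forall i j, holo (fun x => F x i j).

Lemma eq_holo f f' : f =1 f' -> holo f -> holo f'.
Proof. by move=> /funext ->. Qed.

Lemma holo_cst c : holo (fun=> c).
Proof. by move=> x; apply: differentiable_cst. Qed.

Lemma holoM f f' : holo f -> holo f' -> holo (fun x => f x * f' x).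
Proof. by move=> hf hf' x; exact: (differentiableM (hf x) (hf' x)). Qed.

Lemma holo_sum (I : Type) (r : seq I) (P : pred I) (F : I -> E -> C) :
  (forall i, holo (F i)) -> holo (fun x => \sum_(i <- r | P i) F i x).
Proof.
move=> hF; elim: r => [|i r IHr].
  by apply: eq_holo (holo_cst 0) => x; rewrite big_nil.
case Pi: (P i); last by apply: eq_holo IHr => x; rewrite big_cons Pi.
apply: (@eq_holo (F i \+ (fun x => \sum_(i <- r | P i) F i x))).
  by move=> x; rewrite big_cons Pi.
by move=> x; exact: (differentiableD (hF i x) (IHr x)).
Qed.

Lemma holo_mulmxl r s t (A : 'M[C]_(t, r)) (F : E -> 'M[C]_(r, s)) :
  holo_mx F -> holo_mx (fun x => A *m F x).
Proof.
move=> hF i j; apply: (@eq_holo (fun x => \sum_k A i k * F x k j)).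
  by move=> x; rewrite mxE.
by apply: holo_sum => k; apply: holoM (hF k j); apply: holo_cst.
Qed.

Lemma holo_mulmxr r s t (A : 'M[C]_(s, t)) (F : E -> 'M[C]_(r, s)) :
  holo_mx F -> holo_mx (fun x => F x *m A).
Proof.
move=> hF i j; apply: (@eq_holo (fun x => \sum_k F x i k * A k j)).
  by move=> x; rewrite mxE.
by apply: holo_sum => k; apply: holoM (hF i k) _; apply: holo_cst.
Qed.

Lemma holo_mx_sum r s (I : Type) (w : seq I) (P : pred I) (F : I -> E -> 'M[C]_(r, s)) :
  (forall k, holo_mx (F k)) -> holo_mx (fun x => \sum_(k <- w | P k) F k x).
Proof.
move=> hF i j; apply: (@eq_holo (fun x => \sum_(k <- w | P k) F k x i j)).
  by move=> x; rewrite summxE.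
by apply: holo_sum => k; apply: hF.
Qed.

Lemma holo_mx_id : holo_mx id.
Proof. by move=> i j x; apply: differentiable_coord. Qed.

End Holomorphic.

Section HolomorphicKuranishi.
Variables (R : realType) (n p q : nat).
Local Notation C := (Cplx R).
Local Notation g := 'rV[C]_n.
Local Notation N := (ext_dim n).
Local Notation E := 'M[C]_(p, q).
Variables (br : {bilinear g -> g -> g}) (dotg : {dot g for Num.conj}).

(** The source space is arbitrary because the equations of the cylinder are functions on forms with
    values in the quotient by the centre. *)
Lemma holo_schouten (F G : E -> 'M[C]_(N, n)) : holo_mx F -> holo_mx G ->
  holo_mx (fun x => schouten br (F x) (G x)).
Proof.
move=> hF hG; apply: holo_mx_sum => a'; apply: holo_mx_sum => b'.
apply: holo_mulmxl => i j.
pose a := enum_rank [set a']%SET; pose b := enum_rank [set b']%SET.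
apply: (@eq_holo _ _ _ (fun x => \sum_k \sum_l
    F x a k * (G x b l * br (delta_mx 0 k) (delta_mx 0 l) i j))).
  move=> x; rewrite /coef -/a -/b.
  rewrite [row a (F x)]row_sum_delta [row b (G x)]row_sum_delta linear_sumlz summxE /=.
  apply: eq_bigr => k _; rewrite linear_sumr summxE; apply: eq_bigr => l _.
  by rewrite [br (_ *: _) _]linearZl_LR [br _ (_ *: _)]linearZr_LR !mxE.
do 2![apply: holo_sum => ?]; apply: holoM; first exact: hF.
by apply: holoM; [exact: hG|exact: holo_cst].
Qed.

Hypothesis br_alt : forall x, br x x = 0.

Lemma holo_Phi_ (F : E -> 'M[C]_(N, n)) k : holo_mx F ->
  holo_mx (fun x => Phi_ br dotg (F x) k).
Proof.
have [Ph [K [_ KE _]]] := hodge_operators br dotg.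
move=> hF; elim/ltn_ind: k => -[|[|k]] IHk.
- by move=> i j; apply: eq_holo (holo_cst 0) => x; rewrite mxE.
- exact: hF.
have k2 : (2 <= k.+2)%N by [].
(* Extended by 0 outside the range of summation, since [holo_mx_sum] asks for holomorphy at every
   index. *)
pose S i x := if (0 < i < k.+2)%N then
  schouten br (Phi_ br dotg (F x) i) (Phi_ br dotg (F x) (k.+2 - i)) else 0.
have hS : holo_mx (fun x => (- K) *m \sum_(1 <= i < k.+2) S i x).
  apply/holo_mulmxl/holo_mx_sum => i; rewrite /S.
  case: (boolP (0 < i < k.+2)%N) => [/andP[i1 ik]|_].
    by apply: holo_schouten; apply: IHk; rewrite // ltn_subrL i1.
  by move=> a b; apply: eq_holo (holo_cst 0) => x; rewrite mxE.
move=> a b; apply: eq_holo (hS a b) => x; rewrite (Phi_rec br dotg (F x) k2) [in RHS]KE mulNmx.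
congr (fun_of_matrix (- _) a b); congr (K *m _); apply: eq_big_nat => i ik.
by rewrite /S ik.
Qed.

Lemma holo_obs (F : E -> 'M[C]_(N, n)) : nilpotent_lie br -> holo_mx F ->
  holo_mx (fun x => obs br dotg (F x)).
Proof.
have [Ph [K [PhE _ _]]] := hodge_operators br dotg.
move=> /(Phi_finite dotg br_alt)[M [_ PhiM]] hF.
have hPhi : holo_mx (fun x => \sum_(0 <= k < M) Phi_ br dotg (F x) k).
  by apply: holo_mx_sum => k; apply: holo_Phi_.
have := holo_mulmxl Ph (holo_schouten hPhi hPhi).
move=> h i j; apply: eq_holo (h i j) => x.
by rewrite /obs PhE (@Phi_sum _ _ br dotg M) // => k; apply: PhiM.
Qed.

End HolomorphicKuranishi.

Section NormContinuity.
Variables (R : realType) (n : nat).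
Local Notation C := (Cplx R).
Local Notation g := 'rV[C]_n.
Local Notation N := (ext_dim n).
Variables (br : {bilinear g -> g -> g}) (dotg : {dot g for Num.conj}).

Lemma continuous_sum (T : topologicalType) (I : Type) (r : seq I) (F : I -> T -> C) x :
  (forall i, {for x, continuous (F i)}) ->
  {for x, continuous (fun y => \sum_(i <- r) F i y)}.
Proof.
move=> cF; elim: r => [|i r IHr].
  rewrite (_ : (fun _ => _) = (fun=> 0)); first exact: cst_continuous.
  by apply/funext => y; rewrite big_nil.
rewrite (_ : (fun _ => _) = F i \+ (fun y => \sum_(i <- r) F i y)).
  exact: (continuousD (cF i) IHr).
by apply/funext => y; rewrite big_cons.
Qed.

Lemma conj_continuous : continuous (Num.conj : C -> C).
Proof.
move=> z; apply/(@cvgrPdist_lt C C C (nbhs z) (nbhs_filter z) Num.conj z^*) => e e0.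
near=> w; rewrite -rmorphB norm_conjC; near: w.
exact: (@cvgr_dist_lt C C C (nbhs z) (nbhs_filter z) id z).
Unshelve. all: by end_near. Qed.

(** The norm involves conjugates, so the holomorphy lemmas do not cover it; it is a polynomial in
    the entries and their conjugates. *)
Lemma dot_gform_continuous : continuous (fun mu => dot_gform dotg mu mu).
Proof.
have -> : (fun mu => dot_gform dotg mu mu) = (fun mu =>
    \sum_(i < N) \sum_(j < N) \sum_(k < n) \sum_(l < n)
    (gram_mx dotg i j * dot_mx dotg l k) * (mu i l * (mu j k)^*)).
  apply/funext => mu; rewrite dot_gformE; apply: eq_bigr => i _; apply: eq_bigr => j _.
  rewrite [X in _ * X]mxE mulr_sumr; apply: eq_bigr => k _.
  rewrite [X in _ * (X * _)]mxE mulr_suml mulr_sumr; apply: eq_bigr => l _.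
  by rewrite [X in _ * (_ * X)]mxE [X in _ * (_ * X^*)]mxE; ring.
move=> x; apply: continuous_sum => i; apply: continuous_sum => j.
apply: continuous_sum => k; apply: continuous_sum => l.
have ci : {for x, continuous (fun mu : 'M[C]_(N, n) => mu i l)}.
  exact: coord_continuous.
have cj : {for x, continuous (fun mu : 'M[C]_(N, n) => (mu j k)^*)}.
  by apply: continuous_comp; [exact: coord_continuous|exact: conj_continuous].
have cc : {for x, continuous (fun _ : 'M[C]_(N, n) => gram_mx dotg i j * dot_mx dotg l k)}.
  exact: cst_continuous.
exact: (continuousM cc (continuousM ci cj)).
Qed.

End NormContinuity.
Section Cylinder.
Variables (R : realType) (n : nat).
Local Notation C := (Cplx R).
Local Notation g := 'rV[C]_n.
Local Notation N := (ext_dim n).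
Variables (br : {bilinear g -> g -> g}) (dotg : {dot g for Num.conj}).

Lemma norm_ball_open (eps : C) : 0 < eps ->
  open [set mu : 'M[C]_(N, n) | sqrtC (dot_gform dotg mu mu) < eps].
Proof.
move=> e0.
rewrite (_ : [set mu | _] = (fun mu => dot_gform dotg mu mu) @^-1` ball 0 (eps ^+ 2)).
  apply: open_comp; last by apply: ball_open; apply: exprn_gt0.
  by move=> x _; apply: dot_gform_continuous.
apply/funext => mu; apply/propext; rewrite /= -ball_normE /= sub0r normrN.
have d0 := dot_gform_ge0 dotg mu.
by rewrite (ger0_norm d0) -[X in _ <-> X < _]sqrtCK ltr_pXn2r // ?nnegrE ?sqrtC_ge0 // ltW.
Qed.

(** The equations are the entries of [obs] composed with a linear section [sec] of [pr]. Going down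
    by [pr] and back up by [sec] changes [mu] by a central amount, which [obs] ignores. So V may be
    the whole space, and U is the norm ball in the definition of [Kur]. *)
Lemma kuranishi_cylinder (m : nat) (pr : 'M[C]_(n, m)) :
  (forall x, br x x = 0) -> nilpotent_lie br ->
  let H1 := harmonic_forms br dotg 1 in
  row_full pr -> (forall x : g, x *m pr = 0 <-> lie_centre br x) ->
  forall eps : C, 0 < eps ->
  exists (V A : set 'M[C]_(N, m)) (r : nat)
    (f : 'I_r -> 'M[C]_(N, m) -> C) (U : set 'M[C]_(N, n)),
    [/\ V 0, analytic_subset (tens H1 setT) V f A,
        open U /\ U 0, (forall mu, U mu -> V (mu *m pr)) &
        (forall mu, U mu -> tens H1 setT mu ->
           (Kur br dotg eps mu <-> A (mu *m pr))) /\
        same_ideal (tens H1 setT) U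
          (fun (ij : 'I_N * 'I_n) mu => obs br dotg mu ij.1 ij.2)
          (fun i mu => f i (mu *m pr))].
Proof.
move=> br_alt nil H1 pr_full prZ eps e0.
have sH1 : subspace H1 by exact: harmonic_subspace.
pose sec : 'M[C]_(m, n) := pinvmx pr.
have prK : sec *m pr = 1%:M.
  by rewrite /sec -[LHS]mul1mx mulmxA mulmxKpV // submx_full.
have obs_pr mu : obs br dotg (mu *m pr *m sec) = obs br dotg mu.
  apply: obs_shift => // r; apply/prZ.
  by rewrite mulmxBl -!row_mul -(mulmxA _ sec pr) prK mulmx1 subrr.
pose f (i : 'I_#|{: 'I_N * 'I_n}|) (x : 'M[C]_(N, m)) : C :=
  obs br dotg (x *m sec) (enum_val i).1 (enum_val i).2.
have obs_f mu i : f i (mu *m pr) = obs br dotg mu (enum_val i).1 (enum_val i).2.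
  by rewrite /f obs_pr.
exists setT, [set x | [/\ tens H1 setT x, setT x & forall i, f i x = 0]], _, f.
exists [set mu | sqrtC (dot_gform dotg mu mu) < eps]; split=> //.
- split=> //; first exact: openT.
  move=> i x _; apply: (holo_obs dotg br_alt nil).
  exact/holo_mulmxr/holo_mx_id.
- split; first exact: norm_ball_open.
  by rewrite /= dot_gform0r sqrtC0.
split.
  move=> mu /= mu_eps muH; split=> [[_ _ obs0]|[_ _ f0]].
    by split=> // [|i]; [exact: tensT_mulr|rewrite obs_f obs0 mxE].
  split=> //; apply/matrixP => i j; rewrite mxE.
  by have := f0 (enum_rank (i, j)); rewrite obs_f enum_rankK.
(* Both families are the entries of [obs] up to the enumeration of index pairs, so Kronecker symbols
   serve as coefficients. *)
exists (fun ij k _ => (enum_rank ij == k)%:R), (fun k ij _ => (enum_val k == ij)%:R).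
split=> [ij k|k ij|mu _ _ ij|mu _ _ k].
- by move=> x _; apply: differentiable_cst.
- by move=> x _; apply: differentiable_cst.
- rewrite (bigD1 (enum_rank ij)) //= eqxx mul1r obs_f enum_rankK big1 ?addr0 //.
  by move=> k; rewrite eq_sym => /negPf->; rewrite mul0r.
- rewrite (bigD1 (enum_val k)) //= eqxx mul1r obs_f big1 ?addr0 //.
  by move=> ij; rewrite eq_sym => /negPf->; rewrite mul0r.
Qed.

End Cylinder.
(** * Complex parallelisable deformations *)

Section Parallelisable.
Variables (R : realType) (n : nat).
Local Notation C := (Cplx R).
Local Notation g := 'rV[C]_n.
Local Notation N := (ext_dim n).
Local Notation "M ^~" := (map_mx Num.conj M) (at level 2, format "M ^~").
Variables (br : {bilinear g -> g -> g}) (dotg : {dot g for Num.conj}).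
Local Notation H1 := (harmonic_forms br dotg 1).
Local Notation e_ i := (delta_mx 0 i : g).

Definition eval_mx (T : 'M[C]_(N, n)) : 'M[C]_n :=
  \matrix_(i, j) T (enum_rank [set i]%SET) j.

Lemma eval1E T a : eval1 T a = a *m eval_mx T.
Proof.
rewrite mulmx_sum_row; apply: eq_bigr => i _; congr (_ *: _).
by apply/rowP => j; rewrite !mxE.
Qed.

Lemma conjvK : involutive (@conjv R n).
Proof. by move=> x; rewrite /conjv -map_mx_comp (map_mx_id (@conjCK _)). Qed.

Lemma conjvD x y : conjv (x + y) = conjv x + conjv y :> g.
Proof. exact: map_mxD. Qed.

Lemma conjvN x : conjv (- x) = - conjv x :> g.
Proof. exact: map_mxN. Qed.

Lemma conjvZ c x : conjv (c *: x) = c^* *: conjv x :> g.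
Proof. exact: map_mxZ. Qed.

Lemma coef_degree1 (T : 'M[C]_(N, n)) (S : {set 'I_n}) :
  (forall j, Lam 1 (col j T)) -> #|S| != 1%N -> row (enum_rank S) T = 0.
Proof.
move=> T1 S1; apply/rowP => j; have /LamP/(_ S S1) := T1 j.
by rewrite !mxE.
Qed.

(** The rows of [T] outside degree 1 vanish. *)
Lemma rows_centre (T : 'M[C]_(N, n)) : (forall j, Lam 1 (col j T)) ->
  (forall r, lie_centre br (row r T)) <-> (forall i, lie_centre br (row i (eval_mx T))).
Proof.
move=> T1; have E i : row i (eval_mx T) = row (enum_rank [set i]%SET) T.
  by apply/rowP => j; rewrite !mxE.
split=> [zT i|zT r]; first by rewrite E.
rewrite -[r]enum_valK; have [/cards1P[i ->]|] := boolP (#|enum_val r| == 1%N).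
  by rewrite -E.
by move/(coef_degree1 T1) => ->; case: (lie_centre_subspace br).
Qed.

Lemma harmonic_col (mu : 'M[C]_(N, n)) : tens H1 setT mu -> forall j, H1 (col j mu).
Proof. by move/(tensTP _ (harmonic_subspace br dotg 1)). Qed.

Lemma cond1_rows (mu : 'M[C]_(N, n)) : tens H1 setT mu ->
  tens H1 (lie_centre br) mu <-> (forall r, lie_centre br (row r mu)).
Proof.
move=> /harmonic_col muH.
have := tensP mu (harmonic_subspace br dotg 1) (lie_centre_subspace br) => ->.
by split=> [[]|].
Qed.

Lemma cond2_rows (mu : 'M[C]_(N, n)) : tens H1 setT mu ->
  (forall z y, br z (eval1 mu (conjv y)) = 0) <-> (forall r, lie_centre br (row r mu)).
Proof.
move=> /harmonic_col muH; have mu1 j : Lam 1 (col j mu) by case: (muH j).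
have := rows_centre mu1 => ->; split=> [mu0 i z|zmu z y].
  by rewrite rowE -eval1E -[delta_mx 0 i]conjvK.
by rewrite eval1E; apply: (subspace_mulmx_row _ (lie_centre_subspace br)).
Qed.

Lemma big_card1 (F : {set 'I_n} -> C) : (forall S : {set 'I_n}, #|S| != 1%N -> F S = 0) ->
  \sum_(S : {set 'I_n}) F S = \sum_i F [set i]%SET.
Proof.
move=> F1; rewrite (bigID (fun S : {set 'I_n} => #|S| == 1%N)) /= [X in _ + X]big1 // addr0.
transitivity (\sum_(S in [set [set i]%SET | i in 'I_n]%SET) F S).
  apply: eq_bigl => S; apply/cards1P/imsetP => [[i ->]|[i _ ->]]; by exists i.
by rewrite big_imset /= ?big_set //; move=> i j _ _ /set1_inj.
Qed.

Lemma dbar_mono1 i : dbar_mono br [set i]%SET = dbar_gen br i.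
Proof.
rewrite /dbar_mono finset.big_set1 /=.
rewrite (_ : [set i] :\ i = finset.set0)%SET; last by apply/setP => j; rewrite !inE andNb.
rewrite wedge_mono0 [X in _ ^+ X](_ : _ = 0%N) ?scale1r //.
by apply: eq_card0 => j; rewrite !inE; case: eqP => // ->; rewrite ltnn.
Qed.

Lemma set2_inj (j k j' k' : 'I_n) : (j < k)%N -> (j' < k')%N ->
  [set j; k]%SET = [set j'; k']%SET -> j = j' /\ k = k'.
Proof.
move=> jk jk' E; have : j \in [set j'; k']%SET by rewrite -E set21.
have : k \in [set j'; k']%SET by rewrite -E set22.
rewrite !inE => /orP[]/eqP kE /orP[]/eqP jE //; subst.
- by rewrite ltnn in jk.
- by have := ltn_trans jk jk'; rewrite ltnn.
- by rewrite ltnn in jk.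
Qed.

Lemma dbar_genE i (j k : 'I_n) : (j < k)%N ->
  dbar_gen br i (enum_rank [set j; k]%SET) 0 = - conj_br br (e_ j) (e_ k) 0 i.
Proof.
move=> jk; rewrite /dbar_gen summxE (bigD1 j) //= [X in _ + X]big1 ?addr0; last first.
  move=> j' j'j; rewrite summxE big1 // => k' jk'; rewrite mxE monoE.
  case: eqP => [/set2_inj[]// E|]; last by rewrite mulr0.
  by rewrite E eqxx in j'j.
rewrite summxE (bigD1 k) //= [X in _ + X]big1 ?addr0; last first.
  move=> k' /andP[jk' k'k]; rewrite mxE monoE.
  case: eqP => [/set2_inj[]// _ E|]; last by rewrite mulr0.
  by rewrite E eqxx in k'k.
by rewrite mxE monoE eqxx mulr1.
Qed.


Hypothesis br_alt : forall x, br x x = 0.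

Lemma conjv_delta i : conjv (e_ i) = e_ i.
Proof. by rewrite /conjv map_delta_mx. Qed.

(** Harmonic forms are closed, and the coefficient of dbar mu at E_j /\ E_k is minus the value of
    [mu] on the conjugate of [e_j, e_k]. Antisymmetry and bilinearity give the rest. *)
Lemma harmonic_commutator mu x y : tens H1 setT mu -> eval1 mu (conjv (br x y)) = 0.
Proof.
move=> /harmonic_col muH; have mu1 j : Lam 1 (col j mu) by case: (muH j).
have Dmu : dbar_mx br *m mu = 0.
  by apply/eq_cols => j; rewrite colE -mulmxA -colE (harmonic_closed (muH j)) [RHS]col0.
pose W : set g := [set z | eval1 mu (conjv z) = 0].
have sW : subspace W.
  split=> [|c u v]; rewrite /W /= !eval1E; first by rewrite /conjv map_mx0 mul0mx.
  by move=> u0 v0; rewrite conjvD conjvZ mulmxDl -scalemxAl u0 v0 scaler0 addr0.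
have W_lt (j k : 'I_n) : (j < k)%N -> W (br (e_ j) (e_ k)).
  move=> jk; apply/rowP => l; rewrite mxE eval1E mxE.
  have /matrixP/(_ (enum_rank [set j; k]%SET) l) := Dmu.
  rewrite !mxE -big_set_ord; rewrite big_card1; last first.
    by move=> S S1; have /rowP/(_ l) := coef_degree1 mu1 S1; rewrite !mxE /= => ->; rewrite mulr0.
  move/(congr1 -%R); rewrite oppr0 -sumrN => E; rewrite -[RHS]E; apply: eq_bigr => i _.
  rewrite [in RHS]mxE enum_rankK dbar_mono1 dbar_genE //.
  by rewrite mulNr opprK /conj_br !conjv_delta [eval_mx _ _ _]mxE.
have W_delta (j k : 'I_n) : W (br (e_ j) (e_ k)).
  case: (ltngtP j k) => [/W_lt//|/W_lt Wkj|/val_inj ->].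
    by rewrite br_anti // -scaleN1r; apply: (subspaceZ _ sW).
  by rewrite br_alt; case: sW.
rewrite -[_ = 0]/(W (br x y)) [x]row_sum_delta [y]row_sum_delta linear_sumlz.
apply: subspace_sum => // j _; rewrite linear_sumr; apply: subspace_sum => // k _ /=.
rewrite [br (_ *: _) _]linearZl_LR [br _ (_ *: _)]linearZr_LR.
by do 2![apply: (subspaceZ _ sW)].
Qed.

Section Structure.
(* The sum of [(psi a, a)] and its conjugate is the real vector of [L a], so
   the complex structure with these (0,1)-vectors is [L a |-> L (- 'i a)]. *)
Variables (T : 'M[C]_(N, n)).
Local Notation psi := (eval1 T).
Hypothesis T_centre : forall z a, br z (psi a) = 0.
Hypothesis T_commutator : forall x y, psi (conjv (br x y)) = 0.
Hypothesis T_direct : direct_decomposition (graph01 T) (@conj_gC R n @` graph01 T).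

Let L a : g := psi a + conjv a.

Let psiD a b : psi (a + b) = psi a + psi b.
Proof. by rewrite !eval1E mulmxDl. Qed.

Let psiZ c a : psi (c *: a) = c *: psi a.
Proof. by rewrite !eval1E -scalemxAl. Qed.

Let psiN a : psi (- a) = - psi a.
Proof. by rewrite -scaleN1r psiZ scaleN1r. Qed.

Let LD a b : L (a + b) = L a + L b.
Proof. by rewrite /L psiD conjvD addrACA. Qed.

Let L_real c a : c \is Num.real -> L (c *: a) = c *: L a.
Proof. by move=> cR; rewrite /L psiZ conjvZ (CrealP cR) scalerDr. Qed.

Let L_eq0 a : L a = 0 -> a = 0.
Proof.
move=> /eqP; rewrite addr_eq0 => /eqP psia.
have [_ disj] := T_direct.
have : (psi a, a) = 0 :> gC R n; last by case.
apply: disj; first by exists a.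
(* If psi a = - conj a, then (psi a, a) is also the conjugate of the graph vector of [- a]. *)
exists (psi (- a), - a); first by exists (- a).
by rewrite /conj_gC /= psiN psia opprK conjvK conjvN.
Qed.

Let L_inj : injective L.
Proof.
move=> a b Lab; apply/subr0_eq/L_eq0.
by rewrite LD -scaleN1r L_real ?realN ?real1 // scaleN1r Lab subrr.
Qed.

Let L_surj x : exists a, L a = x.
Proof.
have [+ _] := T_direct => /(_ (x, conjv x)) [_ [_ [[a _ <-] [_ [b _ <-] <-]]]].
(* The two components give x = psi a + conj b = conj a + psi b, hence L a + L b = 2 x; averaging
   avoids proving a = b. *)
move=> [xE cxE]; exists (2^-1 *: (a + b)).
rewrite L_real ?realV ?realn // LD.
have xE' : x = conjv a + psi b by rewrite -[x]conjvK cxE conjvD conjvK.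
have -> : L a + L b = x *+ 2.
  have {}xE : x = psi a + conjv b by [].
  rewrite mulr2n [X in _ = X + _]xE [X in _ = _ + X]xE' /L addrACA.
  by rewrite [conjv a + psi b]addrC [RHS]addrACA [conjv b + _]addrC.
by rewrite -[x *+ 2]scaler_nat scalerA mulVf ?scale1r ?pnatr_eq0.
Qed.

Lemma central_complex_structure : exists J : g -> g,
  [/\ almost_complex J, integrable br J, vectors01 J = graph01 T &
      complex_parallelisable br J].
Proof.
have [M ML] := choice L_surj.
pose J x := L (- 'i *: M x).
have LM a : M (L a) = a by apply: L_inj; rewrite ML.
have JL a : J (L a) = - 'i *: psi a + 'i *: conjv a.
  by rewrite /J LM /L psiZ conjvZ rmorphN /= conjCi opprK.
have JD x y : J (x + y) = J x + J y.
  by rewrite -(ML x) -(ML y) -LD /J !LM scalerDr LD.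
have JZ c x : c \is Num.real -> J (c *: x) = c *: J x.
  by move=> cR; rewrite -(ML x) -L_real // /J !LM scalerA mulrC -scalerA L_real.
have JN x : J (- x) = - J x by rewrite -scaleN1r JZ ?realN ?real1 // scaleN1r.
have vJ : vectors01 J = graph01 T.
  have vE a : real_vector (L a) + 'i *: real_vector (J (L a)) =
      (psi (2 *: a), 2 *: a) :> gC R n.
    rewrite JL /real_vector psiZ; apply: injective_projections => /=.
      rewrite scalerDr !scalerA mulrN -expr2 sqrCi opprK scale1r scaleN1r.
      by rewrite addrACA subrr addr0 scaler_nat mulr2n.
    rewrite /L !conjvD !conjvZ conjvK rmorphN /= conjCi opprK scalerDr !scalerA.
    rewrite mulrN -expr2 sqrCi opprK scale1r scaleN1r addrACA subrr add0r.
    by rewrite scaler_nat mulr2n.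
  apply/seteqP; split=> [_ [x _ <-]|_ [a _ <-]].
    by rewrite -(ML x) vE; exists (2 *: M x).
  exists (L (2^-1 *: a)) => //; rewrite vE scalerA mulfV ?scale1r ?pnatr_eq0 //.
(* As [psi] has central values, [L a, L b] = [conj a, conj b]; as [psi] kills conjugates of
   commutators, this is [L] of its own conjugate, and [J] multiplies it by ['i]. So does replacing
   [L a] by [J (L a)], since only the conj a part counts. *)
have brJ x y : br (J x) y = J (br x y).
  rewrite -(ML x) -(ML y) JL; move: (M x) (M y) => a b.
  have centl z c : br (psi c) z = 0 by rewrite br_anti // T_centre oppr0.
  have brE : br (L a) (L b) = br (conjv a) (conjv b).
    by rewrite linearDl centl add0r linearDr T_centre add0r.
  have -> : br (L a) (L b) = L (conjv (br (conjv a) (conjv b))).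
    by rewrite /L T_commutator add0r conjvK.
  rewrite JL T_commutator scaler0 add0r conjvK linearDl.
  rewrite [br (_ *: _) _]linearZl_LR centl scaler0 add0r [br (_ *: _) _]linearZl_LR.
  by rewrite linearDr T_centre add0r.
exists J; split=> //.
- split=> // x; rewrite {2}/J /J LM scalerA mulrNN -expr2 sqrCi scaleN1r.
  by rewrite -scaleN1r L_real ?realN ?real1 // ML scaleN1r.
- rewrite /integrable vJ => _ _ [_ [a _ <-] <-] [_ [b _ <-] <-].
  pose c := conjv (br (conjv a) (conjv b)).
  exists (psi c, c); first by exists c.
  by rewrite /conj_gC /brC /= T_commutator /conj_br !conjvK T_centre.
- move=> x y; split=> //; rewrite br_anti // brJ -JN; congr J.
  by rewrite [in RHS]br_anti.
Qed.

End Structure.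

(** A polynomial of degree [n] cannot vanish at n + 1 distinct squares. *)
Lemma natural_noneigenvalue (X : 'M[C]_n) :
  exists k : nat, ~~ eigenvalue X (k.+1%:R ^+ 2).
Proof.
apply: contrapT => noX.
have rootX k : root (char_poly X) (k.+1%:R ^+ 2).
  rewrite -eigenvalue_root_char; case: (boolP (eigenvalue X _)) => // kX.
  by case: noX; exists k.
pose rs : seq C := mkseq (fun k => k.+1%:R ^+ 2) n.+1.
suff : (size rs < size (char_poly X))%N by rewrite size_char_poly size_mkseq ltnn.
apply: max_poly_roots.
- exact/monic_neq0/char_poly_monic.
- by apply/allP => _ /mapP[k _ ->].
rewrite mkseq_uniq // => k l /eqP; rewrite eqrXn2 ?ler0n // eqr_nat => /eqP[].
by [].
Qed.

(* The two summands are complementary as soon as 1 - |t|^2 P conj(P) is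
   invertible, P being the matrix of T. *)
Lemma direct_scale_exists (T : 'M[C]_(N, n)) : exists t : C, t != 0 /\
  direct_decomposition (graph01 (t *: T)) (@conj_gC R n @` graph01 (t *: T)).
Proof.
pose P := eval_mx T; have [k kP] := natural_noneigenvalue (P *m P^~).
pose t : C := k.+1%:R^-1; have tn0 : t != 0 by rewrite invr_eq0 pnatr_eq0.
have tC : t^* = t by apply/CrealP; rewrite realV realn.
have eval_tT a : eval1 (t *: T) a = t *: (a *m P).
  rewrite eval1E scalemxAr; congr (a *m _).
  by apply/matrixP => i j; rewrite !mxE.
pose M := 1%:M - (t ^+ 2) *: (P *m P^~).
have M_inj (a : g) : a *m M = 0 -> a = 0.
  rewrite mulmxBr mulmx1 -scalemxAr => /eqP; rewrite subr_eq0 => /eqP aE.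
  apply: contraNeq kP => a0; apply/eigenvalueP; exists a => //.
  by rewrite [in RHS]aE scalerA -exprMn /t mulfV ?pnatr_eq0 // expr1n scale1r.
have uM : M \in unitmx.
  by rewrite -row_free_unit; apply: inj_row_free.
have conj_graph b : conj_gC (eval1 (t *: T) b, b) = (conjv b, t *: (conjv b *m P^~)).
  by rewrite /conj_gC /= eval_tT conjvZ tC /conjv map_mxM.
exists t; split=> //; split=> [[u w]|v [a _ <-] [_ [b _ <-]]].
  (* Solving u = t a P + b and w = a + t b conj(P): eliminating [b] leaves an equation for [a M]. *)
  pose a := (w - t *: (u *m P^~)) *m invmx M.
  pose b := u - t *: (a *m P).
  exists (eval1 (t *: T) a, a), (conj_gC (eval1 (t *: T) (conjv b), conjv b)).
  split; first by exists a.
    by exists (eval1 (t *: T) (conjv b), conjv b) => //; exists (conjv b).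
  rewrite conj_graph conjvK eval_tT; apply: injective_projections => /=.
    by rewrite addrC subrK.
  have : a *m M = w - t *: (u *m P^~) by rewrite mulmxKV.
  rewrite mulmxBr mulmx1 -scalemxAr => /eqP; rewrite subr_eq => /eqP aE.
  rewrite [X in _ = X + _]aE /b mulmxBl scalerBr -scalemxAl scalerA -expr2 -mulmxA.
  by rewrite [t *: _ - _ *: _]addrC addrA addrK subrK.
rewrite conj_graph eval_tT => -[bE aE].
have a0 : a = 0.
  apply: M_inj; apply/eqP; rewrite mulmxBr mulmx1 subr_eq0 -[X in X == _]aE bE.
  by rewrite -scalemxAl scalerA -expr2 -scalemxAr mulmxA.
by rewrite a0 mul0mx scaler0.
Qed.

(** This is [W, conj W] = 0 read on first components: [z] comes from a (1,0)-vector as y - i J y,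
    the value of [T] from a (0,1)-vector as x + i J x, and J-bilinearity makes their bracket
    cancel. *)
Lemma graph_central (T : 'M[C]_(N, n)) (J : g -> g) :
  almost_complex J -> complex_parallelisable br J -> vectors01 J = graph01 T ->
  forall z a, br z (eval1 T a) = 0.
Proof.
move=> [_ _ JJ] brJ vJ z a.
have [x _ xE] : vectors01 J (eval1 T a, a) by rewrite vJ; exists a.
(* Every [z] occurs: conj z is the second component of a (0,1)-vector. *)
have [y _ yE] : vectors01 J (eval1 T (conjv z), conjv z).
  by rewrite vJ; exists (conjv z).
have {xE} <- : x + 'i *: J x = eval1 T a by case: xE.
have {yE} <- : y - 'i *: J y = z.
  case: yE => _ /(congr1 (@conjv R n)).
  by rewrite conjvD conjvZ !conjvK conjCi scaleNr.
rewrite linearBl !linearDr [br (_ *: _) _]linearZl_LR [br (_ *: _) (_ *: _)]linearZl_LR.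
rewrite ![br _ (_ *: _)]linearZr_LR.
have JJ' : br (J y) (J x) = - br y x.
  by have [-> _] := brJ y (J x); have [_ ->] := brJ y x; rewrite JJ.
rewrite JJ'; have [-> _] := brJ y x; have [_ ->] := brJ y x.
by rewrite !scalerN scalerA -expr2 sqrCi scaleN1r opprK [X in _ - X]addrC subrr.
Qed.

Lemma Phi_central (T : 'M[C]_(N, n)) : nilpotent_lie br -> tens H1 setT T ->
  (forall z a, br z (eval1 (Phi br dotg T) a) = 0) ->
  forall r, lie_centre br (row r T).
Proof.
move=> nil TH PhiZ; have muH := harmonic_col TH.
have T1 j : Lam 1 (col j T) by case: (muH j).
have sV := coexact_subspace br dotg 1.
have /(tensTP _ sV) PhiV := Phi_sub_coexact dotg br_alt T nil.
set F := Phi br dotg T in PhiZ PhiV *.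
have F1 j : Lam 1 (col j F).
  rewrite -(subrK T F) linearD /=; apply: (subspaceD (@Lam_subspace R n 1) _ (T1 j)).
  exact/coexact_Lam/PhiV.
have Fz : forall r, lie_centre br (row r F).
  by apply/(rows_centre F1) => i z; rewrite rowE -eval1E PhiZ.
have [Q [QZ QE]] := subspace_projector (lie_centre_subspace br).
have FQ : F *m Q = F by apply/row_matrixP => r; rewrite row_mul QE.
suff TQ : T *m Q = T by move=> r; rewrite -TQ row_mul; apply: QZ.
apply/subr0_eq/eq_cols => j; rewrite [RHS]col0.
(* Since [F] is fixed by [Q], the non-central part of [T] is, up to sign, that of F - T. It is
   coexact by this formula and closed because [T] is, hence zero. *)
have XE : T *m Q - T = (F - T) *m (1%:M - Q).
  by rewrite mulmxBr mulmx1 mulmxBl FQ opprB [RHS]addrC subrKA.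
apply: (@coexact_closed_eq0 _ _ br dotg 1).
  by rewrite XE colE -mulmxA; apply: (subspace_mulmx_col _ sV).
have DT : dbar_mx br *m T = 0.
  by apply/eq_cols => l; rewrite colE -mulmxA -colE (harmonic_closed (muH l)) [RHS]col0.
by rewrite colE mulmxA mulmxBr mulmxA DT mul0mx subrr mul0mx.
Qed.

Lemma central_iff_parallelisable (mu : 'M[C]_(N, n)) :
  nilpotent_lie br -> tens H1 setT mu ->
  (forall z y, br z (eval1 mu (conjv y)) = 0) <->
  (forall t : C,
     direct_decomposition (graph01 (t *: mu)) (@conj_gC R n @` graph01 (t *: mu)) ->
     obs br dotg (t *: mu) = 0 /\
     exists J : g -> g,
       [/\ almost_complex J, integrable br J,
           vectors01 J = graph01 (Phi br dotg (t *: mu)) &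
           complex_parallelisable br J]).
Proof.
move=> nil muH; have sH := harmonic_subspace br dotg 1.
have tmuH t : tens H1 setT (t *: mu).
  by apply/(tensTP _ sH) => j; rewrite linearZ; apply: (subspaceZ _ sH); apply: harmonic_col.
have rows_t t r : row r (t *: mu) = t *: row r mu by rewrite linearZ.
split=> [/(cond2_rows muH) zmu t dt|cond3]; last first.
  (* A single nonzero [t] suffices, because centrality of t mu can be divided by [t]. *)
  have [t [t0 dt]] := direct_scale_exists mu.
  have [_ [J [aJ _ vJ pJ]]] := cond3 t dt.
  have zt := Phi_central nil (tmuH t) (graph_central aJ pJ vJ).
  apply/(cond2_rows muH) => r; have := zt r.
  rewrite rows_t => /(subspaceZ t^-1 (lie_centre_subspace br)).
  by rewrite scalerA mulVf // scale1r.
have ztmu r : lie_centre br (row r (t *: mu)).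
  by rewrite rows_t; apply: (subspaceZ _ (lie_centre_subspace br)).
have [Ph [_ [PhE _ _]]] := hodge_operators br dotg.
split.
  rewrite /obs (Phi_centreE dotg br_alt ztmu) PhE schouten_eq0 ?mulmx0 // => i j.
  exact: ztmu.
rewrite (Phi_centreE dotg br_alt ztmu); apply: central_complex_structure => //.
  by move=> z a; have /(cond2_rows (tmuH t)) := ztmu => /(_ z (conjv a)); rewrite conjvK.
by move=> x y; apply: harmonic_commutator.
Qed.

End Parallelisable.

Theorem theorem5p1 (R : realType) (n : nat)
    (br : {bilinear 'rV[Cplx R]_n -> 'rV[Cplx R]_n -> 'rV[Cplx R]_n})
    (Gam : set 'rV[Cplx R]_n)
    (dotg : {dot 'rV[Cplx R]_n for Num.conj}) :
  lie_bracket br -> nilpotent_lie br -> lie_lattice br Gam ->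
  let H1 := harmonic_forms br dotg 1 in
  (forall mu : 'M[Cplx R]_(ext_dim n, n), tens H1 setT mu ->
     let cond1 := tens H1 (lie_centre br) mu in
     let cond2 := forall z y, br z (eval1 mu (conjv y)) = 0 in
     let cond3 := forall t : Cplx R,
       direct_decomposition (graph01 (t *: mu))
         (@conj_gC R n @` graph01 (t *: mu)) ->
       obs br dotg (t *: mu) = 0 /\
       exists J : 'rV[Cplx R]_n -> 'rV[Cplx R]_n,
         [/\ almost_complex J, integrable br J,
             vectors01 J = graph01 (Phi br dotg (t *: mu)) &
             complex_parallelisable br J] in
     (cond1 <-> cond2) /\ (cond2 <-> cond3)) /\
  (* pr presents the quotient of g by its centre *)
  (forall (m : nat) (pr : 'M[Cplx R]_(n, m)),
     row_full pr -> (forall x : 'rV[Cplx R]_n, x *m pr = 0 <-> lie_centre br x) ->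
     forall eps : Cplx R, 0 < eps ->
     exists (V A : set 'M[Cplx R]_(ext_dim n, m)) (r : nat)
       (f : 'I_r -> 'M[Cplx R]_(ext_dim n, m) -> Cplx R)
       (U : set 'M[Cplx R]_(ext_dim n, n)),
       [/\ V 0, analytic_subset (tens H1 setT) V f A,
           open U /\ U 0, (forall mu, U mu -> V (mu *m pr)) &
           (forall mu, U mu -> tens H1 setT mu ->
              (Kur br dotg eps mu <-> A (mu *m pr))) /\
           (* the same as complex analytic spaces *)
           same_ideal (tens H1 setT) U
             (fun (ij : 'I_(ext_dim n) * 'I_n) mu => obs br dotg mu ij.1 ij.2)
             (fun i mu => f i (mu *m pr))]).
Proof.
move=> [br_alt _] nil _ H1; split=> [mu muH cond1 cond2 cond3|m pr].
  split; last exact: central_iff_parallelisable.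
  by rewrite /cond1 /cond2 (cond1_rows muH) (cond2_rows muH).
exact: kuranishi_cylinder.
Qed.
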